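(* Let $X$ be a space with the homotopy type of a compact connected surface with boundary, and let $G=\pi_1(X)$, a finitely generated free group of rank $m$ with fixed free basis $\{a_1,\dots,a_m\}$. Let $l>0$ be an integer and let $f:X\to X$ be a continuous map with $f_\#\in S_l$. Then \[ h(f)\ge h_\#(f)\ge \log(lm), \] where $h(f)$ is the topological entropy and $h_\#(f)$ is the fundamental group entropy of $f$.
   Context: $f_\#:G\to G$ is the homomorphism induced by $f$ on $\pi_1(X)$. Elements of $G$ are identified with reduced words in the letters $a_i^{\pm1}$ and $|w|$ is the length of the reduced word $w$. Fundamental group entropy: for an endomorphism $\phi$ of $G$ let $L_n(\phi)=\max_i|\phi^n(a_i)|$, and define $h_\#(f)=\lim_{n\to\infty}\log\bigl(L_n(f_\#)^{1/n}\bigr)$. Remnant: an endomorphism $\phi:G\to G$ has remnant when, for each $i$, there is a nontrivial subword of $\phi(a_i)$ which does not cancel in any product of the form $\phi(a_j)^{\pm1}\phi(a_i)\phi(a_k)^{\pm1}$, except for when $j$ or $k$ equals $i$ and the exponent is $-1$. The maximal such noncanceling subword of $\phi(a_i)$ is denoted $\mathrm{Rem}_\phi a_i$. For a generator $a_i$ and a reduced word $w$, $\Phi_{a_i}(w)$ is the number of times that $a_i$ or $a_i^{-1}$ appears in $w$. $S_l$ is the set of endomorphisms $\phi$ of $G$ (having remnant) such that $\Phi_{a_i}(\mathrm{Rem}_\phi a_j)\ge l$ for all generators $a_i,a_j$. *)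

(* Defs.v *)
From HB Require Import structures.
From mathcomp Require Import all_boot all_order all_algebra.
From mathcomp Require Import all_classical all_reals all_analysis.
Import Order.TTheory GRing.Theory Num.Theory.
Import numFieldNormedType.Exports.

Set Implicit Arguments.
Unset Strict Implicit.
Unset Printing Implicit Defensive.

Local Open Scope classical_set_scope.
Local Open Scope ring_scope.

(* Elements of the free group on a_0, ..., a_(m-1) are reduced words.         *)
(* The letter (i, true) stands for a_i and (i, false) for its inverse.        *)

Section words.
Context {m : nat}.

Definition letter : Type := 'I_m * bool.

Definition inv_letter (x : letter) : letter := (x.1, ~~ x.2).

Definition reduced (w : seq letter) : bool :=
  sorted (fun x y => y != inv_letter x) w.

Definition push (x : letter) (w : seq letter) : seq letter :=
  if w is y :: w' then if y == inv_letter x then w' else x :: w else [:: x].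

Definition reduce (w : seq letter) : seq letter := foldr push [::] w.

Definition inv_word (w : seq letter) : seq letter := rev (map inv_letter w).

Lemma inv_letterK : involutive inv_letter.
Proof. by case=> i b; rewrite /inv_letter /= negbK. Qed.

Lemma reduced_behead x w : reduced (x :: w) -> reduced w.
Proof. by case: w => [//|y w] /= /andP[]. Qed.

Lemma reduced_push x w : reduced w -> reduced (push x w).
Proof.
case: w => [//|y w] rw /=; case: ifPn => [_|xy].
  exact: reduced_behead rw.
by rewrite /reduced /= xy.
Qed.

Lemma reduced_foldr_push u w : reduced w -> reduced (foldr push w u).
Proof. by move=> rw; elim: u => //= x u IHu; apply: reduced_push. Qed.

Lemma reduced_reduce w : reduced (reduce w).
Proof. exact: reduced_foldr_push. Qed.

Lemma push_reduced x w : reduced (x :: w) -> push x w = x :: w.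
Proof. by case: w => [//|y w] /= /andP[/negPf ->]. Qed.

Lemma reduce_id w : reduced w -> reduce w = w.
Proof.
rewrite /reduce; elim: w => //= x w IHw rxw.
by rewrite IHw ?(reduced_behead rxw)// push_reduced.
Qed.

Lemma push_invK x w : reduced w -> push (inv_letter x) (push x w) = w.
Proof.
case: w => [_|y w rw] /=; first by rewrite inv_letterK eqxx.
case: eqP => [yE|_] /=; last by rewrite inv_letterK eqxx.
by rewrite -yE push_reduced.
Qed.

Lemma push_Kinv x w : reduced w -> push x (push (inv_letter x) w) = w.
Proof. by move=> rw; rewrite -{1}[x]inv_letterK push_invK. Qed.

Lemma foldr_push_push x w v : reduced w ->
  foldr push w (push x v) = push x (foldr push w v).
Proof.
case: v => [//|y v] rw /=; case: eqP => [->|//].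
by rewrite push_Kinv ?reduced_foldr_push.
Qed.

Lemma foldr_push_foldr u v w : reduced w ->
  foldr push w (foldr push v u) = foldr push (foldr push w v) u.
Proof.
by move=> rw; elim: u => //= x u IHu; rewrite foldr_push_push ?IHu.
Qed.

Lemma foldr_push_inv w : reduced w -> foldr push w (inv_word w) = [::].
Proof.
rewrite /inv_word; elim: w => //= x w IHw rxw.
have rw := reduced_behead rxw.
by rewrite rev_cons foldr_rcons -[in LHS]push_reduced// push_invK ?IHw.
Qed.

Lemma inv_wordK : involutive inv_word.
Proof.
by move=> w; rewrite /inv_word map_rev revK (mapK inv_letterK).
Qed.

Lemma reduced_inv w : reduced w -> reduced (inv_word w).
Proof.
rewrite /reduced /inv_word rev_sorted sorted_map; apply: sub_sorted => x y /=.
by apply: contra_neq => ->; rewrite inv_letterK.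
Qed.

End words.

Arguments letter : clear implicits.

Record free_group (m : nat) := FreeGroup {
  word_of :> seq (letter m);
  _ : reduced word_of }.

HB.instance Definition _ (m : nat) := [isSub for @word_of m].
HB.instance Definition _ (m : nat) := [Choice of free_group m by <:].

Section free_group.
Context {m : nat}.
Implicit Types u v w : free_group m.

Lemma word_ofP w : reduced w. Proof. by case: w. Qed.

Definition fg_one : free_group m := @FreeGroup m [::] isT.

Definition fg_mul u v : free_group m :=
  FreeGroup (reduced_foldr_push u (word_ofP v)).

Definition fg_inv u : free_group m := FreeGroup (reduced_inv (word_ofP u)).

Lemma fg_mulE u v : word_of (fg_mul u v) = reduce (u ++ v).
Proof. by rewrite /reduce foldr_cat -/(reduce v) reduce_id ?word_ofP. Qed.

Lemma fg_mulA : associative fg_mul.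
Proof.
by move=> u v w; apply: val_inj; rewrite /= foldr_push_foldr ?word_ofP.
Qed.

Lemma fg_mul1 : left_id fg_one fg_mul.
Proof. by move=> u; apply: val_inj. Qed.

Lemma fg_mulr1 : right_id fg_one fg_mul.
Proof.
by move=> u; apply: val_inj => /=; rewrite -/(reduce u) reduce_id ?word_ofP.
Qed.

Lemma fg_mulV : left_inverse fg_one fg_inv fg_mul.
Proof. by move=> u; apply: val_inj; rewrite /= foldr_push_inv ?word_ofP. Qed.

Lemma fg_mulrV : right_inverse fg_one fg_inv fg_mul.
Proof.
move=> u; apply: val_inj; rewrite /= -[X in foldr _ _ X]inv_wordK.
by rewrite foldr_push_inv ?reduced_inv ?word_ofP.
Qed.

HB.instance Definition _ := isGroup.Build (free_group m)
  fg_mulA fg_mul1 fg_mulr1 fg_mulV fg_mulrV.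

Definition gen (i : 'I_m) : free_group m := @FreeGroup m [:: (i, true)] isT.

Definition signed (g : free_group m) (e : bool) : free_group m :=
  if e then g else (g^-1)%g.

End free_group.

Notation endo m := {multiplicative free_group m -> free_group m}.

Section remnant.
Context {m : nat}.
Implicit Types (phi : endo m) (p s q r : seq (letter m)).

(* The factor s of the reduced word p ++ s ++ q does not cancel in the       *)
(* product u * (p ++ s ++ q) * v: reducing what lies on either side of s      *)
(* already yields a reduced word.                                             *)
Definition survives u p s q v : bool :=
  reduced (reduce (u ++ p) ++ s ++ reduce (q ++ v)).

Definition noncanceling phi (i : 'I_m) s : Prop :=
  s != [::] /\ exists p q, word_of (phi (gen i)) = p ++ s ++ q /\
    forall (j k : 'I_m) (ej ek : bool),
      (j, ej) != (i, false) -> (k, ek) != (i, false) ->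
      survives (signed (phi (gen j)) ej) p s q (signed (phi (gen k)) ek).

Definition has_remnant phi : Prop :=
  forall i, exists s, noncanceling phi i s.

Definition is_Rem phi (i : 'I_m) r : Prop :=
  noncanceling phi i r /\ forall s, noncanceling phi i s -> infix s r.

Definition occurrences (i : 'I_m) (w : seq (letter m)) : nat :=
  count (fun x => x.1 == i) w.

Definition S_ (l : nat) : set (endo m) :=
  [set phi | has_remnant phi /\
    forall j, exists2 r, is_Rem phi j r &
      forall i, (l <= occurrences i r)%N].

End remnant.

Section paths.
Context {R : realType} {X : topologicalType}.
Implicit Types (x y : X) (p q : R -> X).

Definition is_path x y p : Prop :=
  [/\ {within `[0, 1], continuous p}, p 0 = x & p 1 = y].

Definition is_loop x p : Prop := is_path x x p.

Definition concat p q : R -> X :=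
  fun t => if t <= 2^-1 then p (2 * t) else q (2 * t - 1).

Definition inv_path p : R -> X := fun t => p (1 - t).

Definition path_homotopic p q : Prop := exists H : R * R -> X,
  [/\ {within `[0, 1] `*` `[0, 1], continuous H},
      forall t : R, t \in `[0, 1] -> H (t, 0) = p t /\ H (t, 1) = q t &
      forall s : R, s \in `[0, 1] -> H (0, s) = p 0 /\ H (1, s) = p 1].

(* cls, which is only constrained on loops at x, is the quotient map onto     *)
(* pi_1(X, x) followed by a group isomorphism from pi_1(X, x) to G.           *)
Definition is_pi1 (G : groupType) x (cls : (R -> X) -> G) : Prop :=
  [/\ forall p q, is_loop x p -> is_loop x q ->
        (cls p = cls q <-> path_homotopic p q),
      forall p q, is_loop x p -> is_loop x q ->
        cls (concat p q) = (cls p * cls q)%g &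
      forall g, exists2 p, is_loop x p & cls p = g].

(* f need not fix the base point x, so the induced map of pi_1(X, x) is taken *)
(* along a path alpha from x to f x (constant if f x = x, for instance).      *)
Definition is_induced (G : groupType) x (cls : (R -> X) -> G)
    (f : X -> X) (alpha : R -> X) (phi : G -> G) : Prop :=
  is_path x (f x) alpha /\
  forall p, is_loop x p ->
    phi (cls p) = cls (concat (concat alpha (f \o p)) (inv_path alpha)).

End paths.

Section surfaces.
Variable R : realType.

Definition homotopic (X Y : topologicalType) (f g : X -> Y) : Prop :=
  exists H : X * R -> Y,
    {within setT `*` `[0, 1], continuous H} /\
    forall x, H (x, 0) = f x /\ H (x, 1) = g x.

Definition homotopy_equivalent (X Y : topologicalType) : Prop :=
  exists (f : X -> Y) (g : Y -> X),
    [/\ continuous f, continuous g, homotopic (g \o f) id &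
        homotopic (f \o g) id].

Definition half_plane : set (R * R) := [set z | 0 <= z.2].

Definition is_chart (S : topologicalType) (U : set S) (h : S -> R * R) : Prop :=
  [/\ open U,
      exists2 V : set (R * R), open V & h @` U = V `&` half_plane,
      {within U, continuous h} &
      exists2 g : R * R -> S, {within h @` U, continuous g} &
        forall x, U x -> g (h x) = x].

Definition is_surface (S : topologicalType) : Prop :=
  [/\ hausdorff_space S, @second_countable S &
      forall x : S, exists U h, is_chart U h /\ U x].

Definition manifold_boundary (S : topologicalType) : set S :=
  [set x | exists U h, [/\ is_chart U h, U x & (h x).2 = 0]].

Definition has_bounded_surface_type (X : topologicalType) : Prop :=
  exists S : topologicalType,
    [/\ is_surface S, compact [set: S], connected [set: S],
        @manifold_boundary S !=set0 & homotopy_equivalent X S].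

End surfaces.

(* The logarithm is extended by lne 0 = -oo, which is relevant only if some   *)
(* power of phi is trivial.  The limits here and in cover_entropy exist in    *)
(* \bar R by subadditivity.                                                   *)
Definition pi1_entropy (R : realType) (m : nat) (phi : endo m) : \bar R :=
  let L n := (\max_(i < m) size (word_of (iter n phi (gen i))))%N in
  limn (fun n => lne (((L n)%:R `^ n%:R^-1)%:E : \bar R)).

Section topological_entropy.
Variables (R : realType) (X : topologicalType).
Implicit Types (A : set (set X)) (f : X -> X).

Definition open_cover A : Prop :=
  (forall U, A U -> open U) /\ cover A id = setT.

(* Least cardinality of a finite subcover, +oo if there is none. *)
Definition min_subcover A : \bar R :=
  ereal_inf [set (k%:R)%:E | k in [set k : nat | exists B : set (set X),
    [/\ B `<=` A, cover B id = setT & (B #= `I_k)%card]]].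

(* The join of A, f^-1(A), ..., f^-(n-1)(A). *)
Definition iterated_join f A (n : nat) : set (set X) :=
  [set \bigcap_(k in `I_n) (iter k f @^-1` U k) |
    U in [set U : nat -> set X | forall k, `I_n k -> A (U k)]].

Definition cover_entropy f A : \bar R :=
  limn (fun n => (n%:R^-1)%:E * lne (min_subcover (iterated_join f A n)))%E.

(* Entropy in the sense of Adler, Konheim and McAndrew.  It is +oo when X is  *)
(* not compact, as some open cover then has no finite subcover.               *)
Definition top_entropy f : \bar R :=
  ereal_sup [set cover_entropy f A | A in [set A | open_cover A]].

End topological_entropy.

(* Main.v *)
(* Upper bound of the fundamental group entropy, after Bowen and Manning.     *)
(* The free group G acts on a covering of X, pulled back from the universal   *)
(* covering of the surface S by a homotopy equivalence g : X -> S, and f      *)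
(* lifts to a map F of the covering such that F (u z) = phi(u) F(z).  Cover   *)
(* the covering by the G-translates of finitely many sheets.  If A is a cover *)
(* of X by small open sets, the sets of A visited by x, f x, ..., f^n x and   *)
(* the sheet of a lift z of x determine the sheet of F^n z.  Hence the image  *)
(* under F^n of a lift of a loop gamma meets at most c N(A^(n+1)) translates   *)
(* of sheets.  As this image is connected, the word length of phi^n(gamma) is *)
(* at most c' n N(A^(n+1)), where the factor n accounts for the path from the *)
(* base point to its n-th iterate.                                            *)
(*   Since X is not assumed to be locally connected, no covering space is     *)
(* constructed: its points over x are represented by elements of G through a  *)
(* morphism Lam from the fundamental groupoid of X to G, which exists because *)
(* X is path connected, and its topology by the homotopy classes of the paths *)
(* of S lying in small discs.                                                 *)
(*   Lower bound: the remnants of the letters of a reduced word w all survive *)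
(* in phi(w), so that |phi(w)| >= l m |w|.                                    *)

Require Import Defs.
From HB Require Import structures.
From mathcomp Require Import all_boot all_order all_algebra.
From mathcomp Require Import all_classical all_reals all_analysis.
From mathcomp Require Import ring lra zify.
Import Order.TTheory GRing.Theory Num.Theory.
Import numFieldNormedType.Exports.

Set Implicit Arguments.
Unset Strict Implicit.
Unset Printing Implicit Defensive.

Local Open Scope classical_set_scope.
Local Open Scope ring_scope.

(** * Reduced words and remnants *)

(** Both inequalities are about the word lengths of the iterates [phi^n(a_i)]. For the lower one,
    the remnants of consecutive letters survive together ([survivors_meet]), so [phi] multiplies
    word length by at least [l m] ([wlen_remnant]); iterating from a generator gives
    [pi1_entropy_ge].

    For the upper one, [ang] records, along a path, the translate of a sheet in which the lift lies.
    A surface has a base of open sets in which transport does not depend on the path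
    ([surface_locally_nice]). This makes the record locally constant, and the lift of f changes it
    by a locally constant coefficient ([tcoef_near]). On the members of the cover [coding] these
    coefficients are constant, so an itinerary and an initial translate determine the final one.
    Hence the number of final translates along the n-th image of a loop is at most a constant times
    the size N of a subcover of the join. Successive translates differ by elements of bounded
    length, so an intermediate value argument ([jumps_le_card]) bounds the resulting element of G by
    a multiple of N ([len_iter_path]). The motion of the base point costs a factor linear in n
    ([len_iter_loop]), which [growth_rate_le] discards; both rates are limits by [fekete]. *)

Section reduced_words.
Context {m : nat}.
Implicit Types (x y : letter m) (u v w p q s : seq (letter m)).
Implicit Types g h : free_group m.

Lemma reduced_cat_cons u x v :
  reduced (u ++ x :: v) = reduced (rcons u x) && reduced (x :: v).
Proof.
by case: u => [//|y u]; rewrite /reduced /= cat_path rcons_path /= andbA.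
Qed.

Lemma reduced_catl u v : reduced (u ++ v) -> reduced u.
Proof. by case: u => [//|y u]; rewrite /reduced /= cat_path => /andP[]. Qed.

Lemma reduced_catr u v : reduced (u ++ v) -> reduced v.
Proof. by elim: u => [//|x u IHu] /reduced_behead. Qed.

Lemma reduced_cat_overlap u s v :
  s != [::] -> reduced (u ++ s) -> reduced (s ++ v) -> reduced (u ++ s ++ v).
Proof.
case: s => [//|x s] _; rewrite !cat_cons !reduced_cat_cons => /andP[-> _].
by [].
Qed.

Lemma inv_word_cat u v : inv_word (u ++ v) = inv_word v ++ inv_word u.
Proof. by rewrite /inv_word map_cat rev_cat. Qed.

Lemma size_inv_word u : size (inv_word u) = size u.
Proof. by rewrite /inv_word size_rev size_map. Qed.

Lemma inv_word_nil u : (inv_word u == [::]) = (u == [::]).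
Proof. by rewrite -!size_eq0 size_inv_word. Qed.

Lemma occurrences_inv i u : occurrences i (inv_word u) = occurrences i u.
Proof. by rewrite /occurrences /inv_word count_rev count_map; apply: eq_count.
  Qed.

Lemma sum_occurrences w : (\sum_(i < m) occurrences i w)%N = size w.
Proof.
elim: w => [|x w IHw]; first by rewrite big1.
rewrite /= -IHw big_split /= -add1n; congr addn.
by rewrite (bigD1 x.1)//= eqxx big1 ?addn0// => i; rewrite eq_sym => /negPf ->.
Qed.

Definition to_fg w : free_group m := FreeGroup (reduced_reduce w).

Lemma to_fgK g : to_fg g = g.
Proof. by apply: val_inj; rewrite /= reduce_id ?word_ofP. Qed.

Lemma to_fg_nil : to_fg [::] = 1%g. Proof. exact: val_inj. Qed.

Lemma to_fg_cat u v : to_fg (u ++ v) = (to_fg u * to_fg v)%g.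
Proof.
apply: val_inj; rewrite /= /reduce foldr_cat foldr_push_foldr//.
exact: reduced_reduce.
Qed.

Lemma word_ofV g : word_of (g^-1)%g = inv_word g. Proof. by []. Qed.

Lemma word_ofM g h : word_of (g * h)%g = reduce (g ++ h).
Proof. exact: fg_mulE. Qed.

Lemma to_fgV w : to_fg (inv_word w) = ((to_fg w)^-1)%g.
Proof.
elim: w => [|x w IHw]; first exact: val_inj.
rewrite -cat1s inv_word_cat !to_fg_cat IHw invgM; congr (_ * _)%g.
by apply: val_inj.
Qed.

Lemma reduce_inv_word w : reduce (inv_word w) = inv_word (reduce w).
Proof. exact: (congr1 (@word_of m) (to_fgV w)). Qed.

Lemma reduce_mid u v w : reduce (u ++ reduce v ++ w) = reduce (u ++ v ++ w).
Proof.
suff E : to_fg (u ++ reduce v ++ w) = to_fg (u ++ v ++ w).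
  exact: (congr1 (@word_of m) E).
by rewrite !to_fg_cat -[reduce v]/(word_of (to_fg v)) to_fgK.
Qed.

(** All cancellation in a product of two reduced words happens at the junction: a suffix [r] of the
    first meets its inverse. *)
Lemma reduce_cancel u v : reduced u -> reduced v ->
  exists u1 r v1, [/\ u = u1 ++ r, v = inv_word r ++ v1 &
    reduce (u ++ v) = u1 ++ v1].
Proof.
move=> ru rv; elim: u ru => [_|x u IHu rxu].
  by exists [::], [::], v; split; rewrite //= reduce_id.
have [u1 [r [v1 [uE vE red]]]] := IHu (reduced_behead rxu).
have -> : reduce ((x :: u) ++ v) = push x (u1 ++ v1) by rewrite -red.
case: u1 => [|y u1] in uE red *; last first.
  exists (x :: y :: u1), r, v1; split; [by rewrite uE | by [] |].
  rewrite /=; case: ifP => // /eqP yE; move: rxu.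
  by rewrite uE yE /reduced /= eqxx.
case: v1 => [|y v1] in vE red *; first by exists [:: x], r, [::]; rewrite uE.
rewrite /=; case: ifP => [/eqP yE|_]; last first.
  by exists [:: x], r, (y :: v1); rewrite uE.
exists [::], (x :: r), v1; split; [by rewrite uE | | by []].
by rewrite vE yE -cat1s (inv_word_cat [:: x] r) -catA.
Qed.

(** After cancellation [q ++ p'] becomes [u ++ v]. If [u] is empty, the first survival hypothesis
    already concerns [s ++ v ++ s' ++ q']; if [v] is empty, the second one applies symmetrically.
    Otherwise the junctions [s ++ u] and [v ++ s'] are inherited from the two original reduced
    words. *)
Lemma survivors_meet p s q p' s' q' :
  reduced (p ++ s ++ q) -> reduced (p' ++ s' ++ q') -> s != [::] -> s' != [::]
    ->
  reduced (s ++ reduce (q ++ p' ++ s' ++ q')) ->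
  reduced (reduce (p ++ s ++ q ++ p') ++ s') ->
  reduced (s ++ reduce (q ++ p') ++ s').
Proof.
move=> rx ry s0 s'0 H1 H2.
have rq : reduced q by apply: reduced_catr (reduced_catr rx).
have rp' : reduced p' by apply: reduced_catl ry.
have rsq := reduced_catr rx; have rs'q' := reduced_catr ry.
have [u [r [v [qE pE cE]]]] := reduce_cancel rq rp'.
have rc := reduced_reduce (q ++ p').
have e1 : reduce (q ++ p' ++ s' ++ q') = reduce (u ++ v ++ s' ++ q').
  have := reduce_mid [::] (q ++ p') (s' ++ q'); rewrite /= cE.
  by rewrite -!catA => ->.
have e2 : reduce (p ++ s ++ q ++ p') = reduce (p ++ s ++ u ++ v).
  have := reduce_mid (p ++ s) (q ++ p') [::]; rewrite /= cE !cats0.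
  by rewrite -!catA => ->.
rewrite {}e1 in H1; rewrite {}e2 in H2; rewrite {}cE in rc *.
have rpsu : reduced (p ++ s ++ u).
  by move: rx; rewrite qE !catA; apply: reduced_catl.
have rvsq : reduced (v ++ s' ++ q').
  by move: ry; rewrite pE -!catA; apply: reduced_catr.
case: u => [|z u] in qE rc H1 H2 rpsu *.
  rewrite /= (reduce_id rvsq) in H1; rewrite /=.
  by move: H1; rewrite !catA; apply: reduced_catl.
case: v => [|y v] in pE rc H1 H2 rvsq *.
  rewrite cats0 (reduce_id rpsu) in H2; rewrite cats0.
  by move: H2; rewrite -!catA; apply: reduced_catr.
have r1 : reduced (s ++ z :: u) by apply: reduced_catr rpsu.
have r2 : reduced ((y :: v) ++ s').
  by move: rvsq; rewrite catA; apply: reduced_catl.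
have r3 : reduced ((z :: u) ++ (y :: v) ++ s') by apply: reduced_cat_overlap.
by rewrite -catA; apply: reduced_cat_overlap.
Qed.

End reduced_words.

(** * Growth of word length under endomorphisms *)

Section free_group_growth.
Context {m : nat}.
Implicit Types (x y : letter m) (w : seq (letter m)) (g h : free_group m).
Implicit Type phi : endo m.

Lemma endo1 phi : phi 1%g = 1%g.
Proof. by apply: (mulgI (phi 1%g)); rewrite -gmulfM !mulg1. Qed.

Lemma endoV phi g : phi (g^-1)%g = ((phi g)^-1)%g.
Proof. by apply: (mulgI (phi g)); rewrite -gmulfM !mulgV endo1. Qed.

Definition wlen g : nat := size (word_of g).

Lemma wlenV g : wlen (g^-1)%g = wlen g.
Proof. exact: size_inv_word. Qed.

Lemma wlenM g h : (wlen (g * h)%g <= wlen g + wlen h)%N.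
Proof.
rewrite /wlen word_ofM -size_cat; elim: (word_of g ++ word_of h) => //= x w IHw.
rewrite /reduce /= -/(reduce w); case: (reduce w) IHw => //= y v IHv.
by case: ifP => _ /=; lia.
Qed.

Definition letter_fg x : free_group m := signed (gen x.1) x.2.

Lemma word_of_letter x : word_of (letter_fg x) = [:: x].
Proof. by case: x => i []. Qed.

Lemma to_fg_cons x w : to_fg (x :: w) = (letter_fg x * to_fg w)%g.
Proof.
by rewrite -cat1s to_fg_cat -(word_of_letter x) to_fgK.
Qed.

Lemma wlen_morph phi g (L : nat) : (forall i, wlen (phi (gen i)) <= L)%N ->
  (wlen (phi g) <= wlen g * L)%N.
Proof.
move=> phiL; rewrite -(to_fgK g) {2}to_fgK {2}/wlen.
elim: (word_of g) => [|x w IHw].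
  by rewrite to_fg_nil endo1.
rewrite to_fg_cons gmulfM mulSn (leq_trans (wlenM _ _))// leq_add//.
by case: x => i []; rewrite /letter_fg /= ?endoV ?wlenV.
Qed.

Lemma wlen_iter_submul phi (i : 'I_m) (n k : nat) (L := fun n : nat =>
    (\max_(j < m) wlen (iter n phi (gen j)))%N) :
  (wlen (iter (n + k) phi (gen i)) <= L n * L k)%N.
Proof.
have iterM j : exists psi : endo m, iter j phi =1 psi.
  elim: j => [|j [psi psiE]]; first by exists idfun.
  by exists (phi \o psi) => g /=; rewrite psiE.
have [psi psiE] := iterM n; rewrite iterD psiE mulnC.
apply: leq_trans (wlen_morph (L := L n) _ _) _ => [j|].
  by rewrite -psiE; apply: (leq_bigmax (F := fun j => wlen (iter n phi (gen
    j)))).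
rewrite leq_mul2r.
by rewrite (leq_bigmax (F := fun j => wlen (iter k phi (gen j)))) orbT.
Qed.

(* Writing phi(x) = P x ++ S x ++ Q x, the cancellations inside a product     *)
(* phi(x_1) ... phi(x_n) only affect the words Q x_i ++ P x_(i+1).            *)
Lemma wlen_remnant phi (l : nat) g : S_ l phi ->
  (l * m * wlen g <= wlen (phi g))%N.
Proof.
move=> [_ Hrem].
have /choice[rpq rpqP] : forall j : 'I_m, exists rpq : seq (letter m) * (seq
  (letter m) * seq (letter m)),
    let: (r, (p, q)) := rpq in
    [/\ r != [::], word_of (phi (gen j)) = p ++ r ++ q,
    (forall (i k : 'I_m) (ei ek : bool), (i, ei) != (j, false) ->
      (k, ek) != (j, false) ->
      survives (signed (phi (gen i)) ei) p r q (signed (phi (gen k)) ek)) &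
    forall i, (l <= occurrences i r)%N].
  move=> j; have [r [[r0 [p [q [E sv]]]] _] rl] := Hrem j.
  by exists (r, (p, q)).
pose S x := if x.2 then (rpq x.1).1 else inv_word (rpq x.1).1.
pose P x := if x.2 then (rpq x.1).2.1 else inv_word (rpq x.1).2.2.
pose Q x := if x.2 then (rpq x.1).2.2 else inv_word (rpq x.1).2.1.
pose f x := word_of (phi (letter_fg x)).
have S0 x : S x != [::].
  rewrite /S; case: (rpq x.1) (rpqP x.1) => [r [p q]] [r0 _ _ _] /=.
  by case: x.2; rewrite ?inv_word_nil.
have fE x : f x = P x ++ S x ++ Q x.
  rewrite /f /P /S /Q /letter_fg.
  case: (rpq x.1) (rpqP x.1) => [r [p q]] [_ E _ _] /=.
  case: x.2 => //=.
  by rewrite endoV word_ofV E !inv_word_cat catA.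
have Sl x i : (l <= occurrences i (S x))%N.
  rewrite /S; case: (rpq x.1) (rpqP x.1) => [r [p q]] [_ _ _ rl] /=.
  by case: x.2; rewrite ?occurrences_inv.
have SV x : S (inv_letter x) = inv_word (S x).
  by rewrite /S /=; case: x.2 => //=; rewrite inv_wordK.
have PV x : Q (inv_letter x) = inv_word (P x).
  by rewrite /P /Q /=; case: x.2 => //=; rewrite inv_wordK.
have fV x : f (inv_letter x) = inv_word (f x).
  rewrite /f -word_ofV -endoV; congr (word_of (phi _)).
  by rewrite /letter_fg /=; case: x.2 => //=; rewrite invgK.
have fs i e : word_of (signed (phi (gen i)) e) = f (i, e).
  by rewrite /f /letter_fg /=; case: e; rewrite //= endoV.
have H1 x y : y != inv_letter x -> reduced (S x ++ reduce (Q x ++ f y)).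
  case: x y => [i b] [k e] yx; rewrite /S /Q /=.
  case: (rpq i) (rpqP i) => [r [p q]] [r0 E sv _] /=.
  (* Only one neighbour matters here; [phi (gen i)] itself, always admissible, fills the other
     side. *)
  have ii : (i, true) != (i, false) by rewrite xpair_eqE andbF.
  case: b yx => /= yx.
    have /= := sv i k true e ii yx; rewrite /survives !fs.
    exact: reduced_catr.
  (* For an inverse letter, survival of [r] against a left neighbour is inverted. *)
  have xy : (k, ~~ e) != (i, false).
    by apply: contra_neq yx => -[-> /negbFE ->].
  have /= := sv k i (~~ e) true xy ii; rewrite /survives !fs => rs.
  have /reduced_inv : reduced (reduce (f (k, ~~ e) ++ p) ++ r).
    by move: rs; rewrite catA; apply: reduced_catl.
  rewrite inv_word_cat.
  by rewrite -reduce_inv_word inv_word_cat -fV /inv_letter /= negbK.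
have H2 x y : y != inv_letter x -> reduced (reduce (f x ++ P y) ++ S y).
  move=> yx; rewrite -[X in reduced X]inv_wordK; apply: reduced_inv.
  rewrite inv_word_cat -SV -reduce_inv_word inv_word_cat -PV -fV.
  by apply: H1; apply: contra_neq yx => ->; rewrite inv_letterK.
have rf x : reduced (P x ++ S x ++ Q x) by rewrite -fE /f word_ofP.
have meet x y : y != inv_letter x ->
    reduced (S x ++ reduce (Q x ++ P y) ++ S y).
  move=> yx; apply: (survivors_meet (p := P x) (q' := Q y)) => //.
  - by rewrite -fE; apply: H1.
  - by have := H2 _ _ yx; rewrite fE -!catA.
(* [P x ++ F x w] is the reduced form of the image of [x :: w]: each [Q x ++ P y] is reduced
   separately, and [meet] controls the junctions. *)
pose F := fix F x w := if w is y :: w'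
  then S x ++ reduce (Q x ++ P y) ++ F y w' else S x ++ Q x.
have Fstart x w : exists t, F x w = S x ++ t.
  by case: w => [|y w] /=; eexists.
have FP w : forall x, reduced (x :: w) -> reduced (P x ++ F x w) /\
    word_of (phi (to_fg (x :: w))) = P x ++ F x w.
  elim: w => [|y w IHw] x.
    move=> _ /=; split; first exact: rf.
    by rewrite to_fg_cons to_fg_nil mulg1 -/(f x) fE.
  move=> rxyw; have /andP[yx _] := rxyw.
  have [rF phiE] := IHw _ (reduced_behead rxyw).
  have red : reduced (P x ++ F x (y :: w)).
    rewrite /=; apply: reduced_cat_overlap => //.
      by have := rf x; rewrite catA; apply: reduced_catl.
    have [t Ft] := Fstart y w; rewrite Ft.
    have := reduced_cat_overlap (u := S x ++ reduce (Q x ++ P y)) (v := t) (S0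
      y).
    rewrite -!catA; apply; first exact: meet.
    by rewrite -Ft; apply: reduced_catr rF.
  split=> //; rewrite to_fg_cons gmulfM word_ofM phiE -/(f x) fE -(reduce_id
    red).
  have /= := reduce_mid (P x ++ S x) (Q x ++ P y) (F y w).
  by rewrite -!catA => ->.
have Fl x w i : (l * (size w).+1 <= occurrences i (F x w))%N.
  rewrite /occurrences; elim: w x => [|y w IHw] x /=; rewrite !count_cat.
    by rewrite muln1 (leq_trans (Sl x i))// leq_addr.
  by rewrite mulnS leq_add ?Sl// (leq_trans (IHw y))// leq_addl.
have := word_ofP g; rewrite -[g in phi g]to_fgK /wlen.
case: (word_of g) => [|x w] rg; first by rewrite muln0.
have [_ ->] := FP w x rg; rewrite size_cat; apply: leq_trans (leq_addl _ _).
(* Each of the m generators occurs at least [l] times in every factor [S], whence [l m] per letter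
   of [g]. *)
rewrite -[size (F x w)]sum_occurrences [(l * m)%N]mulnC -mulnA.
apply: (@leq_trans (\sum_(i < m) l * (size w).+1)%N).
  by rewrite sum_nat_const card_ord.
by apply: leq_sum => i _; apply: Fl.
Qed.

End free_group_growth.

(** * Entropies as limits *)

Section subadditive_sequences.
Context {R : realType}.

(** The limit is the infimum of the quotients with positive index: if index [p.+1] nearly attains
    it, Euclidean division of n by [p.+1] bounds [u n / n] by [u p.+1 / p.+1] plus a vanishing
    term. *)
Lemma fekete (u : nat -> R) : (forall n k, u (n + k)%N <= u n + u k) ->
  (forall n, 0 <= u n) -> cvgn (fun n => u n / n%:R).
Proof.
move=> subadd u0; pose E := [set u n.+1 / n.+1%:R | n in [set: nat]].
have E0 : E !=set0 by exists (u 1 / 1%:R), 0.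
have Elb : has_lbound E by exists 0 => _ [n _ <-]; rewrite divr_ge0.
have Einf : has_inf E by split.
apply/cvg_ex; exists (inf E); apply/cvgrPdist_le => e e0.
have e20 : 0 < e / 2 by rewrite divr_gt0.
have [_ [p _ <-] pE] := inf_adherent e20 Einf.
(* Bounds [u r] for every possible remainder r. *)
pose M := \sum_(r < p.+1) u r.
have uq q r : u (q * p.+1 + r)%N <= q%:R * u p.+1 + u r.
  elim: q => [|q IHq]; first by rewrite mul0r add0r.
  rewrite mulSn -addnA (le_trans (subadd _ _))// -natr1 mulrDl mul1r; lra.
near=> n.
have n0 : 0 < n%:R :> R by rewrite ltr0n; near: n; exists 1%N.
have Mn : M / n%:R <= e / 2.
  rewrite ler_pdivrMr// mulrC -ler_pdivrMr//; near: n.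
  exact: nbhs_infty_ger.
have lo : inf E <= u n / n%:R.
  by apply: ge_inf => //; exists n.-1 => //; rewrite prednK// -(ltr0n R).
rewrite distrC ger0_norm ?subr_ge0// lerBlDl.
rewrite (le_trans (y := u p.+1 / p.+1%:R + M / n%:R))//; last first.
  by rewrite [e]splitr addrA lerD// ltW.
rewrite -(ler_pM2r n0) mulfVK ?gt_eqF// mulrDl mulfVK ?gt_eqF//.
rewrite {1}(divn_eq n p.+1) (le_trans (uq _ _))// lerD//.
  rewrite -mulrA mulrC ler_wpM2l// mulrC ler_pdivlMr ?ltr0n// -natrM ler_nat.
  exact: leq_trunc_div.
have lt_r : (n %% p.+1 < p.+1)%N by rewrite ltn_mod.
rewrite /M (bigD1 (Ordinal lt_r))//= lerDl; apply: sumr_ge0 => i _; exact: u0.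
Unshelve. all: by end_near. Qed.

Lemma ln_nat_sublinear (e : R) : 0 < e ->
  \forall n \near \oo, ln (n.+1%:R : R) <= e * n%:R.
Proof.
move=> e0; near=> n.
have n1 : 1 <= n%:R :> R by rewrite ler1n; near: n; exists 1%N.
have n8 : 8 / e ^+ 2 <= n%:R by near: n; exact: nbhs_infty_ger.
have s0 : 0 < Num.sqrt (n.+1%:R : R) by rewrite sqrtr_gt0.
have -> : ln (n.+1%:R : R) = ln (Num.sqrt n.+1%:R) * 2%:R.
  by rewrite mulr_natr -lnXn// sqr_sqrtr.
rewrite (le_trans (y := Num.sqrt n.+1%:R * 2%:R))//.
  by rewrite ler_pM2r// ltW// ln_sublinear.
rewrite -ler_sqr ?nnegrE ?mulr_ge0 ?sqrtr_ge0 ?(ltW e0)//.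
rewrite exprMn sqr_sqrtr//.
have : 8 <= n%:R * e ^+ 2 by rewrite -ler_pdivrMr// exprn_gt0.
move=> /(ler_wpM2r (ltW (lt_le_trans ltr01 n1))) h.
(* It remains to compare [2 sqrt(n+1)] with [e n]; after squaring, [4 (n+1) <= 8 n] explains the
   threshold [8 / e^2]. *)
have -> : (e * n%:R) ^+ 2 = n%:R * e ^+ 2 * n%:R by ring.
by apply: le_trans h; rewrite -natr1; lra.
Unshelve. all: by end_near. Qed.

Lemma ln_submultiplicative (u : nat -> nat) : (forall n, (0 < u n)%N) ->
  (forall n k, (u (n + k)%N <= u n * u k)%N) ->
  cvgn (fun n => ln ((u n)%:R : R) / n%:R).
Proof.
move=> u0 usub; apply: fekete => [n k|n]; last by rewrite ln_ge0// ler1n.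
by rewrite -lnM ?posrE ?ltr0n// ler_ln ?posrE ?mulr_gt0 ?ltr0n// -natrM ler_nat.
Qed.

(** The factors [C], [n.+1] and [N 1], the last one from [N n.+1 <= N n * N 1], add only o(n) to the
    logarithm. *)
Lemma growth_rate_le (L N : nat -> nat) (C : nat) :
  (forall n, (0 < L n)%N) -> (forall n, (0 < N n)%N) ->
  (forall n k, (L (n + k)%N <= L n * L k)%N) ->
  (forall n k, (N (n + k)%N <= N n * N k)%N) ->
  (forall n, (L n <= C * n.+1 * N n.+1)%N) ->
  limn (fun n => ln ((L n)%:R : R) / n%:R) <=
  limn (fun n => ln ((N n)%:R : R) / n%:R).
Proof.
move=> L0 N0 Lsub Nsub LN.
have C0 : (0 < C)%N by case: C LN => // /(_ 0); rewrite leqNgt L0.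
have cL := ln_submultiplicative L0 Lsub.
have cN := ln_submultiplicative N0 Nsub.
apply/ler_addgt0Pr => e e0; have e20 : 0 < e / 2 by rewrite divr_gt0.
have cNe : (fun n => ln ((N n)%:R : R) / n%:R + e) @ \oo -->
    limn (fun n => ln ((N n)%:R : R) / n%:R) + e.
  by apply: cvgD; [exact: cN | exact: cvg_cst].
apply: (ler_cvg_to cL cNe).
near=> n.
have n0 : 0 < n%:R :> R by rewrite ltr0n; near: n; exists 1%N.
rewrite ler_pdivrMr// mulrDl mulfVK ?gt_eqF//.
have h1 : ln (n.+1%:R : R) <= e / 2 * n%:R.
  by near: n; apply: ln_nat_sublinear.
have h2 : ln (C%:R : R) + ln (N 1)%:R <= e / 2 * n%:R.
  by rewrite mulrC -ler_pdivrMr//; near: n; exact: nbhs_infty_ger.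
have h3 : (L n <= C * n.+1 * (N n * N 1))%N.
  by apply: leq_trans (LN n) _; rewrite leq_mul2l -(addn1 n) Nsub orbT.
apply: (@le_trans _ _ (ln (C%:R * n.+1%:R * ((N n)%:R * (N 1)%:R)))).
  rewrite ler_ln ?posrE ?mulr_gt0 ?ltr0n// -!natrM ler_nat//.
rewrite !lnM ?posrE ?mulr_gt0 ?ltr0n//.
have -> : e * n%:R = e / 2 * n%:R + e / 2 * n%:R by rewrite -mulrDl -splitr.
lra.
Unshelve. all: by end_near. Qed.

Lemma pi1_entropyE (m : nat) (phi : endo m)
    (L := fun n => (\max_(i < m) wlen (iter n phi (gen i)))%N) :
  (forall n, (0 < L n)%N) -> (forall n k, (L (n + k)%N <= L n * L k)%N) ->
  pi1_entropy R phi = (limn (fun n => ln ((L n)%:R : R) / n%:R))%:E.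
Proof.
move=> L0 Lsub; rewrite /pi1_entropy -EFin_lim; last exact:
  ln_submultiplicative.
congr (limn _); apply/funext => n; rewrite -/(L n).
by rewrite lne_EFin ?powR_gt0 ?ltr0n// ln_powR mulrC.
Qed.

End subadditive_sequences.

(** * Cardinalities of subcovers of iterated joins *)

Section subcovers.
Context {R : realType} {X : topologicalType}.
Implicit Types (A : set (set X)) (f : X -> X).

(** Repetitions are allowed, which makes products and images of families easy; [min_subcoverP] shows
    that the least [k] is still that of [min_subcover]. *)
Definition covers_by A (k : nat) : Prop := exists W : 'I_k -> set X,
  (forall i, A (W i)) /\ forall x, exists i, W i x.

Lemma covers_by_fin A (T : finType) (W : T -> set X) :
  (forall i, A (W i)) -> (forall x, exists i, W i x) -> covers_by A #|T|.
Proof.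
move=> AW Wcov; exists (W \o enum_val); split=> [i|x]; first exact: AW.
by have [i Wx] := Wcov x; exists (enum_rank i); rewrite /= enum_rankK.
Qed.

Lemma covers_by_card A B k : B `<=` A -> cover B id = setT ->
  (B #= `I_k)%card -> covers_by A k.
Proof.
move=> BA Bcov /card_esym/ppcard_eqP[g].
exists (fun i : 'I_k => g (val i)); split=> [i|x].
  by apply: BA; apply: (@funS _ _ `I_k B g); apply: ltn_ord.
have [b Bb bx] : cover B id x by rewrite Bcov.
have [i ik gi] := @surj _ _ _ _ g b Bb.
by exists (Ordinal ik); rewrite /= gi.
Qed.

Lemma min_subcoverP A (k : nat) : covers_by A k ->
  exists N : nat, [/\ min_subcover R A = (N%:R)%:E, covers_by A N &
    forall k', covers_by A k' -> (N <= k')%N].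
Proof.
move=> Ak.
have exK : exists k, `[< covers_by A k >] by exists k; apply/asboolP.
case: (ex_minnP exK) => N /asboolP AN Nmin; exists N.
have {}Nmin k' : covers_by A k' -> (N <= k')%N.
  by move=> Ak'; apply: Nmin; apply/asboolP.
split=> //; apply/eqP; rewrite eq_le; apply/andP; split; last first.
  apply: le_ereal_inf_tmp => _ [k' [B [BA Bcov Bk']] <-].
  by rewrite lee_fin ler_nat; apply: Nmin; apply: covers_by_card Bk'.
have [W [AW Wcov]] := AN.
have [k' Wk'] : finite_set (range W) by exact: finite_image.
apply: (@le_trans _ _ (k'%:R)%:E).
  apply: ereal_inf_lbound; exists k' => //; exists (range W); split=> //.
    by move=> _ [i _ <-].
  apply/seteqP; split=> // x _; have [i Wx] := Wcov x.
  by exists (W i) => //; exists i.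
rewrite lee_fin ler_nat -card_le_II.
have h1 : (`I_k' #<= range W)%card by have /card_eqPle[] := Wk'.
apply: card_le_trans h1 _; apply: card_le_trans (card_image_le _ _) _.
by have /card_eqPle[] := @card_II N.
Qed.

Lemma min_subcover_pinfty A : (forall k, ~ covers_by A k) ->
  min_subcover R A = +oo%E.
Proof.
move=> noA; rewrite /min_subcover (_ : [set _ | _ in _] = set0) ?ereal_inf0//.
apply/seteqP; split=> // t [k' [B [BA Bcov Bk']] tE].
exact: noA (covers_by_card BA Bcov Bk').
Qed.

Lemma covers_by_joinS f A n k :
  covers_by (iterated_join f A n.+1) k -> covers_by A k.
Proof.
move=> [W [AW Wcov]].
have /choice[U UP] i : exists U, A U /\ W i `<=` U.
  have [U AU <-] := AW i; exists (U 0); split; first exact: AU.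
  by move=> x /(_ 0); apply.
exists U; split=> [i|x]; first by have [] := UP i.
by have [i Wx] := Wcov x; exists i; have [_] := UP i; apply.
Qed.

Lemma covers_by_join_le f A n n' k : (n <= n')%N ->
  covers_by (iterated_join f A n') k -> covers_by (iterated_join f A n) k.
Proof.
move=> nn' [W [AW Wcov]].
have /choice[V VP] i : exists V, iterated_join f A n V /\ W i `<=` V.
  have [U AU <-] := AW i; exists (\bigcap_(l in `I_n) (iter l f @^-1` U l)).
  split; last by move=> x Ux l ln; apply: Ux; exact: leq_trans ln nn'.
  by exists U => // l ln; apply: AU; exact: leq_trans ln nn'.
exists V; split=> [i|x]; first by have [] := VP i.
by have [i Wx] := Wcov x; exists i; have [_] := VP i; apply.
Qed.

(** Itineraries are concatenated: the last [k] sets are those visited from [iter n f x] on. *)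
Lemma covers_by_joinD f A n k p q : covers_by (iterated_join f A n) p ->
  covers_by (iterated_join f A k) q ->
  covers_by (iterated_join f A (n + k)) (p * q).
Proof.
move=> [W [AW Wcov]] [W' [AW' Wcov']].
have -> : (p * q)%N = #|{: 'I_p * 'I_q}| by rewrite card_prod !card_ord.
apply: (@covers_by_fin _ _ (fun ij => W ij.1 `&` iter n f @^-1` W' ij.2)).
  move=> [i j] /=; have [U AU <-] := AW i; have [U' AU' <-] := AW' j.
  exists (fun l => if (l < n)%N then U l else U' (l - n)%N).
    move=> l /= lnk; case: ifPn => [|/negbTE] ln; first exact: AU.
    by apply: AU' => /=; lia.
  apply/seteqP; split=> x /=.
    move=> xU; split=> [l /= ln|l /= lk].
      by have := xU l; rewrite /= ln; apply; lia.
    have /= := xU (l + n)%N; rewrite addnK iterD ifN; last by lia.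
    by apply; lia.
  move=> [xU xU'] l /= lnk; case: ifPn => ln; first exact: xU.
  have /= := xU' (l - n)%N; rewrite -iterD subnK; last by lia.
  by apply; lia.
move=> x; have [i Wi] := Wcov x; have [j Wj] := Wcov' (iter n f x).
by exists (i, j).
Qed.

Lemma covers_by_join f A n p : covers_by A p ->
  covers_by (iterated_join f A n) (p ^ n).
Proof.
move=> [W [AW Wcov]].
(* An intersection over no index is [setT]. *)
have j0 : covers_by (iterated_join f A 0) 1.
  exists (fun=> setT); split=> [_|x]; last by exists ord0.
  exists (fun=> set0) => //; apply/seteqP; split=> // x _ k; by [].
have j1 : covers_by (iterated_join f A 1) p.
  exists W; split=> // i; exists (fun=> W i) => //.
  apply/seteqP; split=> x /=; first by move=> /(_ 0); apply.
  by move=> Wx [].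
elim: n => [|n IHn]; first by rewrite expn0.
by rewrite -addn1 expnD expn1; apply: covers_by_joinD.
Qed.

(** Without a finite subcover of [A] the entropy is infinite. Otherwise every join has one, and
    [N n] is its least size, positive because of the point [x0]. *)
Lemma cover_entropyP f A (x0 : X) :
  cover_entropy R f A = +oo%E \/
  exists N : nat -> nat,
  [/\ cover_entropy R f A = (limn (fun n => ln ((N n)%:R : R) / n%:R))%:E,
      forall n, (0 < N n)%N,
      forall n, covers_by (iterated_join f A n) (N n),
      forall n k, covers_by (iterated_join f A n) k -> (N n <= k)%N &
      forall n k, (N (n + k) <= N n * N k)%N].
Proof.
have [[p Ap]|noA] := pselect (exists p, covers_by A p); last first.
  (* The index 0 is excluded since [0^-1 = 0]. *)
  left; apply/cvg_lim => //; apply: cvg_near_cst; exists 1%N => // n /= n1.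
  rewrite min_subcover_pinfty/= ?gt0_muley ?lte_fin ?invr_gt0 ?ltr0n//.
  move=> k; rewrite -(prednK n1) => /covers_by_joinS Ak.
  by apply: noA; exists k.
right.
have /choice[N NP] n := min_subcoverP (covers_by_join f n Ap).
have Nsub n k : (N (n + k) <= N n * N k)%N.
  have [_ _] := NP (n + k)%N; apply; have [_ Nn _] := NP n.
  by have [_ Nk _] := NP k; apply: covers_by_joinD.
have Ncov n : covers_by (iterated_join f A n) (N n) by have [] := NP n.
have N0 n : (0 < N n)%N.
  have [W [_ /(_ x0)[i _]]] := Ncov n.
  exact: leq_trans (ltn_ord i).
exists N; split=> //; last by move=> n k; have [_ _] := NP n; apply.
rewrite -EFin_lim; last exact: ln_submultiplicative.
congr (limn _); apply/funext => n; have [-> _ _] := NP n.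
by rewrite lne_EFin ?ltr0n// -EFinM mulrC.
Qed.

End subcovers.
(** * Paths and homotopies *)

Section real_paths.
Context {R : realType}.
Implicit Types (T X Z : topologicalType).

Lemma within_continuous_comp T X Z (D : set X) (F : X -> Z) (a : T -> X) :
  {within D, continuous F} -> continuous a -> (forall t, D (a t)) ->
  continuous (F \o a : T -> Z).
Proof.
move=> /subspace_continuousP cF ca Da t V /= FV.
have /= h := cF (a t) (Da t) V FV.
have h' : \forall y \near t, D (a y) -> V (F (a y)) by exact: ca h.
have : \forall y \near t, V (F (a y)) by near=> y; apply: (near h' y).
exact.
Unshelve. all: by end_near. Qed.

Lemma if_continuous T X (c : T -> R) (F G : T -> X) : continuous c ->
  continuous F -> continuous G -> (forall z, c z = 0 -> F z = G z) ->
  continuous (fun z => if c z <= 0 then F z else G z).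
Proof.
move=> cc cF cG FG z V HV.
suff : \forall y \near z, V (if c y <= 0 then F y else G y) by [].
have [cz|cz|cz0] := ltgtP (c z) 0.
- have FV : \forall y \near z, V (F y).
    by apply: cF; move: HV; rewrite (ltW cz).
  have cV : \forall y \near z, c y < 0 by have := cc z _ (lt_nbhsl cz).
  by near=> y; rewrite ltW; [near: y | near: y].
- have GV : \forall y \near z, V (G y).
    by apply: cG; move: HV; rewrite leNgt cz.
  have cV : \forall y \near z, 0 < c y by have := cc z _ (lt_nbhsr cz).
  by near=> y; rewrite leNgt ifF; [near: y | apply/negbTE; rewrite negbK;
    near: y].
- have FV : \forall y \near z, V (F y).
    by apply: cF; move: HV; rewrite cz0 lexx.
  have GV : \forall y \near z, V (G y).
    by apply: cG; move: HV; rewrite cz0 lexx FG.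
  by near=> y; case: ifP => _; near: y.
Unshelve. all: by end_near. Qed.

(** The retraction onto [0, 1]: precomposition with it extends continuity from [0, 1] to the whole
    line. *)
Definition clamp (t : R) : R := Num.max 0 (Num.min t 1).

Lemma max_continuous T (a b : T -> R) : continuous a -> continuous b ->
  continuous (fun z => Num.max (a z) (b z)).
Proof. by move=> ca cb z; apply: continuous_max; [exact: ca|exact: cb]. Qed.

Lemma min_continuous T (a b : T -> R) : continuous a -> continuous b ->
  continuous (fun z => Num.min (a z) (b z)).
Proof. by move=> ca cb z; apply: continuous_min; [exact: ca|exact: cb]. Qed.

Lemma addr_continuous T (a b : T -> R) : continuous a -> continuous b ->
  continuous (fun z => a z + b z).
Proof. by move=> ca cb z; apply: continuousD; [exact: ca|exact: cb]. Qed.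

Lemma subr_continuous T (a b : T -> R) : continuous a -> continuous b ->
  continuous (fun z => a z - b z).
Proof. by move=> ca cb z; apply: continuousB; [exact: ca|exact: cb]. Qed.

Lemma mulr_continuous T (a b : T -> R) : continuous a -> continuous b ->
  continuous (fun z => a z * b z).
Proof. by move=> ca cb z; apply: continuousM; [exact: ca|exact: cb]. Qed.

Lemma pair_continuous T X Z (a : T -> X) (b : T -> Z) :
  continuous a -> continuous b -> continuous (fun z => (a z, b z)).
Proof. by move=> ca cb z; apply: cvg_pair; [exact: ca|exact: cb]. Qed.

Lemma comp_continuous T X Z (F : X -> Z) (a : T -> X) :
  continuous F -> continuous a -> continuous (fun z => F (a z)).
Proof. by move=> cF ca z; apply: continuous_comp; [exact: ca|exact: cF]. Qed.

Lemma fst_continuous X Z : continuous (fun z : X * Z => z.1).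
Proof. by move=> z; apply: cvg_fst. Qed.

Lemma snd_continuous X Z : continuous (fun z : X * Z => z.2).
Proof. by move=> z; apply: cvg_snd. Qed.

End real_paths.

(** Proves continuity by recursion on the formula. The continuity of a named outer function must be
    in the context, which is why facts such as that of [clamp] are introduced before calls. *)
Ltac cont := first [ assumption | lazymatch goal with
  | |- continuous (fun x => Num.max (@?a x) (@?b x)) =>
      apply: (@max_continuous _ _ a b); cont
  | |- continuous (fun x => Num.min (@?a x) (@?b x)) =>
      apply: (@min_continuous _ _ a b); cont
  | |- continuous (fun x => @?a x + - @?b x) =>
      apply: (@subr_continuous _ _ a b); cont
  | |- continuous (fun x => @?a x + @?b x) =>
      apply: (@addr_continuous _ _ a b); cont
  | |- continuous (fun x => @?a x * @?b x) =>
      apply: (@mulr_continuous _ _ a b); cont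
  | |- continuous (fun x => (@?a x, @?b x)) =>
      apply: (@pair_continuous _ _ _ a b); cont
  | |- continuous (fun x => x) => move=> ?; exact: cvg_id
  | |- continuous (fun x => x.1) => apply: fst_continuous
  | |- continuous (fun x => x.2) => apply: snd_continuous
  | |- continuous (fun x => ?f (@?a x)) => first [ apply: cst_continuous
      | apply: (@comp_continuous _ _ _ f a); cont ]
  | _ => apply: cst_continuous
  end ].

Section homotopies.
Context {R : realType}.
Implicit Types (T X Z : topologicalType).

Lemma clamp_continuous : continuous (@clamp R).
Proof. by rewrite /clamp; cont. Qed.

Lemma clamp_itv (t : R) : 0 <= clamp t <= 1.
Proof. by rewrite /clamp le_max lexx ge_max ler01 ge_min lexx orbT. Qed.

Lemma clamp_id (t : R) : 0 <= t <= 1 -> clamp t = t.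
Proof. by move=> /andP[t0 t1]; rewrite /clamp min_l// max_r. Qed.

(* The homotopies below are taken between maps defined on the whole real      *)
(* line, of which only the restrictions to [0, 1] matter.                     *)
Definition homot X (p q : R -> X) : Prop := exists H : R * R -> X,
  [/\ continuous H, forall t, 0 <= t <= 1 -> H (t, 0) = p t /\ H (t, 1) = q t &
      forall s, 0 <= s <= 1 -> H (0, s) = p 0 /\ H (1, s) = p 1].

Lemma homot_refl X (p : R -> X) : continuous p -> homot p p.
Proof.
move=> cp; exists (fun z => p z.1); split=> //.
by cont.
Qed.

(** The straight-line homotopy in a convex domain; [clamp] keeps it in [D] for all real
    parameters. *)
Lemma homot_segments X (D : set (R * R)) (F : R * R -> X) (a b c d : R -> R) :
  (forall z w s, D z -> D w -> 0 <= s <= 1 ->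
    D (z.1 + s * (w.1 - z.1), z.2 + s * (w.2 - z.2))) ->
  {within D, continuous F} ->
  continuous a -> continuous b -> continuous c -> continuous d ->
  (forall t, D (a t, b t)) -> (forall t, D (c t, d t)) ->
  a 0 = c 0 -> b 0 = d 0 -> a 1 = c 1 -> b 1 = d 1 ->
  homot (fun t => F (a t, b t)) (fun t => F (c t, d t)).
Proof.
move=> convD cF ca cb cc cd Dab Dcd a0 b0 a1 b1.
exists (F \o (fun z => (a z.1 + clamp z.2 * (c z.1 - a z.1),
  b z.1 + clamp z.2 * (d z.1 - b z.1)))).
split=> [|t t01|s s01] /=.
- apply: within_continuous_comp cF _ _ => [|z]; last first.
    by have := convD _ _ _ (Dab z.1) (Dcd z.1) (clamp_itv z.2).
  have cl : continuous (fun z : R * R => clamp z.2).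
    by have ? : continuous (@clamp R) := @clamp_continuous; cont.
  have cz (e : R -> R) : continuous e -> continuous (fun z : R * R => e z.1).
    by move=> ce; cont.
  have := (cz _ ca, cz _ cb, cz _ cc, cz _ cd) => -[[[c1 c2] c3] c4].
  by cont.
- rewrite !clamp_id ?lexx ?ler01// !mul0r !addr0 !mul1r.
  by rewrite ![_ + (_ - _)]addrC !subrK.
- by rewrite -a0 -b0 -a1 -b1 !subrr !mulr0 !addr0.
Qed.

Lemma homot_plane X (F : R * R -> X) (a b c d : R -> R) : continuous F ->
  continuous a -> continuous b -> continuous c -> continuous d ->
  a 0 = c 0 -> b 0 = d 0 -> a 1 = c 1 -> b 1 = d 1 ->
  homot (fun t => F (a t, b t)) (fun t => F (c t, d t)).
Proof.
move=> cF ca cb cc cd a0 b0 a1 b1.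
refine (@homot_segments X setT F a b c d _ _ ca cb cc cd _ _ a0 b0 a1 b1) => //.
exact: continuous_subspaceT.
Qed.

Lemma homot_reparam X (p : R -> X) (a c : R -> R) : continuous p ->
  continuous a -> continuous c -> a 0 = c 0 -> a 1 = c 1 ->
  homot (fun t => p (a t)) (fun t => p (c t)).
Proof.
move=> cp ca cc a0 a1.
apply: (@homot_plane X (fun z => p z.1) a (fun=> 0) c (fun=> 0)) => //.
all: by cont.
Qed.

Lemma continuous_glue X (p q : R -> X) (c : R) : continuous p -> continuous q ->
  p c = q c -> continuous (fun t => if t <= c then p t else q t).
Proof.
move=> cp cq pq.
have -> : (fun t => if t <= c then p t else q t) =
    (fun t => if t - c <= 0 then p t else q t).
  by apply/funext => t; rewrite subr_le0.
apply: (@if_continuous _ _ _ (fun t => t - c)) => //; first by cont.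
by move=> z /eqP; rewrite subr_eq0 => /eqP ->.
Qed.

Lemma concat_continuous X (p q : R -> X) : continuous p -> continuous q ->
  p 1 = q 0 -> continuous (concat p q).
Proof.
move=> cp cq pq; apply: (@continuous_glue _ (fun t => p (2 * t)) (fun t => q
  (2 * t - 1))).
- by cont.
- by cont.
- by rewrite mulfV// subrr.
Qed.

Lemma concat0 X (p q : R -> X) : concat p q 0 = p 0.
Proof. by rewrite /concat invr_ge0 ler0n mulr0. Qed.

Lemma concat1 X (p q : R -> X) : concat p q 1 = q 1.
Proof. by rewrite /concat ifF ?mulr1; [congr q; lra|lra]. Qed.

Lemma inv_path_continuous X (p : R -> X) : continuous p ->
  continuous (inv_path p).
Proof. by move=> cp; apply: comp_continuous => //; cont. Qed.

Lemma comp_concat X Z (f : X -> Z) (p q : R -> X) :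
  f \o concat p q = concat (f \o p) (f \o q).
Proof. by apply/funext => t; rewrite /concat /=; case: ifP. Qed.

Lemma homot_concat X (p p' q q' : R -> X) : p 1 = q 0 -> homot p p' ->
  homot q q' -> homot (concat p q) (concat p' q').
Proof.
move=> pq [H [cH Ht Hs]] [K [cK Kt Ks]].
exists (fun z => if z.1 - 2^-1 <= 0 then H (2 * z.1, clamp z.2)
  else K (2 * z.1 - 1, clamp z.2)).
have cl : continuous (fun z : R * R => clamp z.2).
  by have ? : continuous (@clamp R) := @clamp_continuous; cont.
split=> [|t /andP[t0 t1]|s s01] /=.
- apply: if_continuous => [|||z /eqP]; first by cont.
  + by cont.
  + by cont.
  rewrite subr_eq0 => /eqP ->; rewrite mulfV// subrr.
  by rewrite (Hs _ (clamp_itv _)).2 (Ks _ (clamp_itv _)).1.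
- rewrite !clamp_id ?lexx ?ler01// subr_le0 /concat; case: ifPn => t2.
    by apply: Ht; lra.
  by apply: Kt; lra.
- rewrite concat0 concat1 !clamp_id// ifT; last by lra.
  rewrite ifF; last by lra.
  rewrite mulr0 (Hs _ s01).1; split=> //.
  have -> : 2 * 1 - 1 = 1 :> R by lra.
  by rewrite (Ks _ s01).2.
Qed.

(** Both bracketings are reparametrizations of one path [P] running through [p], [q], [r] on
    [0, 3]. *)
Lemma homot_concatA X (p q r : R -> X) : continuous p -> continuous q ->
  continuous r -> p 1 = q 0 -> q 1 = r 0 ->
  homot (concat (concat p q) r) (concat p (concat q r)).
Proof.
move=> cp cq cr pq qr.
pose P t := if t <= 1 then p t else (if t <= 2 then q (t - 1) else r (t - 2)).
have cP : continuous P.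
  apply: (@continuous_glue _ p (fun t => if t <= 2 then q (t - 1) else r (t -
    2))) => //.
    apply: (@continuous_glue _ (fun t => q (t - 1)) (fun t => r (t - 2))).
    - by cont.
    - by cont.
    - by rewrite subrr -qr; congr q; lra.
  by rewrite ifT ?subrr//; lra.
have := @homot_reparam _ P (fun t => Num.min (4 * t) (2 * t + 1))
  (fun t => Num.max (2 * t) (4 * t - 1)) cP.
have -> : (fun t => P (Num.min (4 * t) (2 * t + 1))) = concat (concat p q) r.
  apply/funext => t; rewrite /P /concat.
  have [t2|t2] := leP t 2^-1.
    rewrite min_l; last by lra.
    have [t4|t4] := leP (2 * t) 2^-1.
      by rewrite ifT; [congr p; lra|lra].
    rewrite ifF; last by lra.
    by rewrite ifT; [congr q; lra|lra].
  rewrite min_r; last by lra.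
  rewrite !ifF; [|lra|lra].
  by congr r; lra.
have -> : (fun t => P (Num.max (2 * t) (4 * t - 1))) = concat p (concat q r).
  apply/funext => t; rewrite /P /concat.
  have [t2|t2] := leP t 2^-1.
    rewrite max_l; last by lra.
    by rewrite ifT; [congr p; lra|lra].
  rewrite max_r; last by lra.
  rewrite ifF; last by lra.
  have [t4|t4] := leP (2 * t - 1) 2^-1.
    by rewrite ifT; [congr q; lra|lra].
  rewrite ifF; last by lra.
  by congr r; lra.
apply; [cont|cont| |].
- by rewrite min_l ?max_l; lra.
- by rewrite min_r ?max_r; lra.
Qed.

Lemma homot_ext X (p p' q q' : R -> X) : homot p q ->
  (forall t, 0 <= t <= 1 -> p t = p' t) ->
  (forall t, 0 <= t <= 1 -> q t = q' t) -> homot p' q'.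
Proof.
move=> [H [cH Ht Hs]] pp' qq'; exists H; split=> // [t t01|s s01].
  by rewrite -pp'// -qq'//; apply: Ht.
by rewrite -!pp' ?lexx ?ler01//; apply: Hs.
Qed.

(** With [P] running through [p] and [q] on [0, 2], the left side moves along [P] from 1 down to 0
    and up to 2, the right side directly from 1 to 2. *)
Lemma homot_cancel X (p q : R -> X) : continuous p -> continuous q ->
  p 1 = q 0 -> homot (concat (inv_path p) (concat p q)) q.
Proof.
move=> cp cq pq.
pose P t := if t <= 1 then p t else q (t - 1).
have cP : continuous P.
  apply: (@continuous_glue _ p (fun t => q (t - 1))) => //; first by cont.
  by rewrite subrr.
apply: (@homot_ext _ (fun t => P (Num.max (1 - 2 * t) (4 * t - 2))) _
  (fun t => P (t + 1))).
- apply: homot_reparam => //; [by cont|by cont| |].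
    by rewrite max_l; lra.
  by rewrite max_r; lra.
- move=> t /andP[t0 t1]; rewrite /P /concat /inv_path.
  have [t2|t2] := leP t 2^-1.
    by rewrite max_l ?ifT//; lra.
  rewrite max_r; last by lra.
  have [t4|t4] := leP (2 * t - 1) 2^-1.
    by rewrite ifT; [congr p; lra|lra].
  by rewrite ifF; [congr q; lra|lra].
- move=> t /andP[t0 t1]; rewrite /P.
  have [t2|t2] := leP (t + 1) 1; last by congr q; lra.
  have -> : t = 0 by lra.
  by rewrite add0r.
Qed.

Lemma homot_path_homotopic X (p q : R -> X) : homot p q -> path_homotopic p q.
Proof.
move=> [H [cH Ht Hs]]; exists H; split.
- exact: continuous_subspaceT.
- by move=> t; rewrite in_itv; apply: Ht.
- by move=> s; rewrite in_itv; apply: Hs.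
Qed.

Lemma clamp_path_continuous X (p : R -> X) : {within `[0, 1], continuous p} ->
  continuous (p \o @clamp R).
Proof.
move=> cp; apply: within_continuous_comp cp _ _; first exact: clamp_continuous.
by move=> t; rewrite /= in_itv; apply: clamp_itv.
Qed.

End homotopies.

(** * Morphisms from the fundamental groupoid to a group *)

Section groupoid_morphisms.
Context {R : realType} {X : topologicalType} {G : groupType}.
Implicit Types (p q : R -> X) (a b c : R).

Definition groupoid_hom (Lam : (R -> X) -> G) : Prop :=
  (forall p q, continuous p -> continuous q -> homot p q -> Lam p = Lam q) /\
  (forall p q, continuous p -> continuous q -> p 1 = q 0 ->
    Lam (concat p q) = (Lam p * Lam q)%g).

(** The case [b < a] is allowed and runs [p] backwards, so that [Lam_subpath] needs no order on the
    parameters. *)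
Definition subpath p a b : R -> X := fun t => p (a + (b - a) * t).

Lemma subpath_continuous p a b : continuous p -> continuous (subpath p a b).
Proof. by move=> cp; rewrite /subpath; cont. Qed.

Lemma subpath0 p a b : subpath p a b 0 = p a.
Proof. by rewrite /subpath mulr0 addr0. Qed.

Lemma subpath1 p a b : subpath p a b 1 = p b.
Proof. by rewrite /subpath mulr1 addrC subrK. Qed.

Lemma subpath01 p : subpath p 0 1 = p.
Proof. by apply/funext => t; rewrite /subpath add0r subr0 mul1r. Qed.

Variables (Lam : (R -> X) -> G) (homL : groupoid_hom Lam).

Lemma Lam_homot p q : continuous p -> continuous q -> homot p q ->
  Lam p = Lam q.
Proof. exact: homL.1. Qed.

Lemma Lam_concat p q : continuous p -> continuous q -> p 1 = q 0 ->
  Lam (concat p q) = (Lam p * Lam q)%g.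
Proof. exact: homL.2. Qed.

Lemma Lam_cst (x : X) : Lam (fun=> x) = 1%g.
Proof.
have cx : continuous (fun _ : R => x) by apply: cst_continuous.
apply: (mulgI (Lam (fun=> x))); rewrite mulg1 -Lam_concat//.
by congr Lam; apply/funext => t; rewrite /concat; case: ifP.
Qed.

Lemma Lam_subpath p a b c : continuous p ->
  (Lam (subpath p a b) * Lam (subpath p b c))%g = Lam (subpath p a c).
Proof.
move=> cp; rewrite -Lam_concat; last by rewrite subpath0 subpath1.
2, 3: exact: subpath_continuous.
pose th t := if t <= 2^-1 then a + (b - a) * (2 * t)
  else b + (c - b) * (2 * t - 1).
have cth : continuous th.
  apply: (@continuous_glue _ _ (fun t => a + (b - a) * (2 * t))
    (fun t => b + (c - b) * (2 * t - 1))); [by cont|by cont|].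
  by rewrite mulfV// subrr mulr0 addr0 mulr1 addrC subrK.
have -> : concat (subpath p a b) (subpath p b c) = (fun t => p (th t)).
  by apply/funext => t; rewrite /concat /subpath /th; case: ifP.
apply: Lam_homot; [by cont|exact: subpath_continuous|].
apply: (@homot_reparam _ _ p th (fun t => a + (c - a) * t)) => //; first by
  cont.
- by rewrite /th ifT; lra.
- by rewrite /th ifF; lra.
Qed.

Lemma Lam_subpath_id p a : Lam (subpath p a a) = 1%g.
Proof.
rewrite -(Lam_cst (p a)); congr Lam; apply/funext => t.
by rewrite /subpath subrr mul0r addr0.
Qed.

Lemma Lam_subpathV p a b : continuous p ->
  Lam (subpath p b a) = ((Lam (subpath p a b))^-1)%g.
Proof.
move=> cp; apply: (mulgI (Lam (subpath p a b))).
by rewrite Lam_subpath// Lam_subpath_id mulgV.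
Qed.

Lemma Lam_inv p : continuous p -> Lam (inv_path p) = ((Lam p)^-1)%g.
Proof.
move=> cp; rewrite -[in RHS](subpath01 p) -Lam_subpathV//; congr Lam.
by apply/funext => t; rewrite /subpath /inv_path; congr p; lra.
Qed.

(** The two ways around the unit square are homotopic because the plane is convex. *)
Lemma Lam_square (H : R * R -> X) : continuous H ->
  (Lam (fun t => H (t, 0%R)) * Lam (fun s => H (1%R, s)))%g =
  (Lam (fun s => H (0%R, s)) * Lam (fun t => H (t, 1%R)))%g.
Proof.
move=> cH; rewrite -!Lam_concat//; try by cont.
have cmin : continuous (fun t : R => Num.min (2 * t) 1) by cont.
have cmax : continuous (fun t : R => Num.max (2 * t - 1) 0) by cont.
have -> : concat (fun t => H (t, 0)) (fun s => H (1, s)) =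
    (fun t => H (Num.min (2 * t) 1, Num.max (2 * t - 1) 0)).
  apply/funext => t; rewrite /concat; have [t2|t2] := leP t 2^-1.
    by rewrite min_l ?max_r//; lra.
  by rewrite min_r ?max_l//; lra.
have -> : concat (fun s => H (0, s)) (fun t => H (t, 1)) =
    (fun t => H (Num.max (2 * t - 1) 0, Num.min (2 * t) 1)).
  apply/funext => t; rewrite /concat; have [t2|t2] := leP t 2^-1.
    by rewrite min_l ?max_r//; lra.
  by rewrite min_r ?max_l//; lra.
apply: Lam_homot; [by cont|by cont|apply: homot_plane => //].
- by rewrite min_l ?max_r; lra.
- by rewrite min_l ?max_r; lra.
- by rewrite min_r ?max_l; lra.
- by rewrite min_r ?max_l; lra.
Qed.

End groupoid_morphisms.

Lemma groupoid_hom_comp (R : realType) (X Y : topologicalType) (G : groupType)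
    (Lam : (R -> X) -> G) (k : Y -> X) : continuous k -> groupoid_hom Lam ->
  groupoid_hom (fun p : R -> Y => Lam (k \o p)).
Proof.
move=> ck [Lh Lc]; split=> [p q cp cq [H [cH Ht Hs]]|p q cp cq pq].
  apply: Lh; [by rewrite /comp; cont|by rewrite /comp; cont|].
  exists (k \o H); split=> [|t t01|s s01]; first by rewrite /comp; cont.
    by have [/= -> ->] := Ht t t01.
  by have [/= -> ->] := Hs s s01.
rewrite comp_concat Lc//=; [by rewrite /comp; cont|by rewrite /comp; cont|].
by rewrite pq.
Qed.

(** * From the fundamental group to the groupoid *)

Section transport.
Context {R : realType} {X : topologicalType} {G : groupType}.
Variables (x0 : X) (cls : (R -> X) -> G).
Hypothesis pi1 : is_pi1 x0 cls.
Implicit Types p q : R -> X.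

(** [cls] takes functions on the whole line, so agreement on [0, 1] has to be turned into a
    homotopy. *)
Lemma cls_ext p q : continuous q -> q 0 = x0 -> q 1 = x0 ->
  (forall t, 0 <= t <= 1 -> p t = q t) -> cls p = cls q.
Proof.
move=> cq q0 q1 pq.
have lq : is_loop x0 q by split=> //; exact: continuous_subspaceT.
have lp : is_loop x0 p.
  split; rewrite ?pq ?lexx ?ler01//.
  apply: (@subspace_eq_continuous _ _ _ q); last exact: continuous_subspaceT.
  by move=> t; rewrite inE /= in_itv /= => /pq.
have [/(_ p q lp lq)[_ hom] _ _] := pi1; apply: hom.
exists (fun z => q z.1); split.
- by apply: continuous_subspaceT; cont.
- by move=> t; rewrite in_itv => /pq.
- by move=> s _; rewrite !pq// ?lexx ?ler01.
Qed.

Lemma cls_homot p q : continuous p -> continuous q -> p 0 = x0 -> p 1 = x0 ->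
  homot p q -> cls p = cls q.
Proof.
move=> cp cq p0 p1 pq; have [H [_ Ht Hs]] := pq.
have lp : is_loop x0 p by split=> //; exact: continuous_subspaceT.
have lq : is_loop x0 q.
  split; first exact: continuous_subspaceT.
    by rewrite -(Ht 0 _).2 ?(Hs 1 _).1 ?lexx ?ler01.
  by rewrite -(Ht 1 _).2 ?(Hs 1 _).2 ?lexx ?ler01.
have [/(_ p q lp lq)[_ hom] _ _] := pi1; apply: hom.
exact: homot_path_homotopic.
Qed.

Lemma cls_concat p q : continuous p -> continuous q -> p 0 = x0 -> p 1 = x0 ->
  q 0 = x0 -> q 1 = x0 -> cls (concat p q) = (cls p * cls q)%g.
Proof.
move=> cp cq p0 p1 q0 q1; have [_ h _] := pi1; apply: h; split=> //;
  exact: continuous_subspaceT.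
Qed.

Lemma cls_cst : cls (fun=> x0) = 1%g.
Proof.
have cx : continuous (fun _ : R => x0) by apply: cst_continuous.
apply: (mulgI (cls (fun=> x0))); rewrite mulg1 -cls_concat//.
by congr cls; apply/funext => t; rewrite /concat; case: ifP.
Qed.

Variable T : X -> R -> X.
Hypothesis cT : forall x, continuous (T x).
Hypothesis T0 : forall x, T x 0 = x0.
Hypothesis T1 : forall x, T x 1 = x.
Hypothesis Tx0 : T x0 = (fun=> x0).

(** A path is closed up into a loop at [x0] by the chosen base paths [T]. *)
Definition transport p : G :=
  cls (concat (concat (T (p 0)) p) (inv_path (T (p 1)))).

Lemma transport_loop p : continuous p -> p 0 = x0 -> p 1 = x0 ->
  transport p = cls p.
Proof.
move=> cp p0 p1; rewrite /transport p0 p1 Tx0.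
have -> : inv_path (fun=> x0) = (fun=> x0) :> (R -> X) by [].
have cx : continuous (fun _ : R => x0) by apply: cst_continuous.
rewrite !cls_concat ?concat0 ?concat1//; last by apply: concat_continuous.
by rewrite cls_cst mul1g mulg1.
Qed.

(** For a concatenation, the base path to the common point is run backwards and then forwards
    between [p] and [q], and cancels. *)
Lemma groupoid_hom_transport : groupoid_hom transport.
Proof.
have cI x := inv_path_continuous (@cT x).
have I0 x : inv_path (T x) 0 = x by rewrite /inv_path subr0.
have I1 x : inv_path (T x) 1 = x0 by rewrite /inv_path subrr.
split=> [p q cp cq pq|p q cp cq pq].
  have [H [_ Ht Hs]] := pq.
  have q0 : q 0 = p 0.
    by rewrite -(Ht 0 _).2 ?(Hs 1 _).1 ?lexx ?ler01.
  have q1 : q 1 = p 1.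
    by rewrite -(Ht 1 _).2 ?(Hs 1 _).2 ?lexx ?ler01.
  rewrite /transport q0 q1; apply: cls_homot; rewrite ?concat0 ?concat1//.
  - by apply: concat_continuous; rewrite ?concat1//; apply: concat_continuous.
  - by apply: concat_continuous; rewrite ?concat1 ?I0//; apply:
    concat_continuous; rewrite ?q0.
  - apply: homot_concat; rewrite ?concat1 ?I0//; last exact: homot_refl.
    by apply: homot_concat => //; apply: homot_refl.
rewrite /transport concat0 concat1 -pq.
set A := T (p 0); set B := T (p 1); set C := T (q 1).
have [A0 A1 B0 B1] : [/\ A 0 = x0, A 1 = p 0, B 0 = x0 & B 1 = p 1].
  by rewrite /A /B !T0 !T1.
have [C0 C1] : C 0 = x0 /\ C 1 = q 1 by rewrite /C T0 T1.
have [cA cB cC] : [/\ continuous A, continuous B & continuous C].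
  by split; apply: cT.
have [cIA cIB cIC] : [/\ continuous (inv_path A),
    continuous (inv_path B) & continuous (inv_path C)] by split; apply: cI.
have IB0 : inv_path B 0 = p 1 by rewrite /B I0.
have IB1 : inv_path B 1 = x0 by rewrite /B I1.
have IC0 : inv_path C 0 = q 1 by rewrite /C I0.
have IC1 : inv_path C 1 = x0 by rewrite /C I1.
have cAp : continuous (concat A p) by apply: concat_continuous.
have cqC : continuous (concat q (inv_path C)) by apply: concat_continuous.
have cBq : continuous (concat B q) by apply: concat_continuous; rewrite // B1.
have cBqC : continuous (concat B (concat q (inv_path C))).
  by apply: concat_continuous; rewrite // concat0 B1.
have cpq : continuous (concat p q) by apply: concat_continuous.
have cW : continuous (concat (concat A p) (inv_path B)).
  by apply: concat_continuous; rewrite // concat1 IB0.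
have cV : continuous (concat (concat B q) (inv_path C)).
  by apply: concat_continuous; rewrite // concat1 IC0.
have cY : continuous (concat (inv_path B) (concat B (concat q (inv_path C)))).
  by apply: concat_continuous; rewrite // concat0 IB1 B0.
have cZ : continuous (concat (concat A p) (concat q (inv_path C))).
  by apply: concat_continuous; rewrite // concat0 concat1.
have cApq : continuous (concat (concat A p) q).
  by apply: concat_continuous; rewrite // concat1.
rewrite -cls_concat ?concat0 ?concat1//.
have -> : cls (concat (concat (concat A p) (inv_path B))
    (concat (concat B q) (inv_path C))) =
  cls (concat (concat (concat A p) (inv_path B)) (concat B (concat q (inv_path
    C)))).
  apply: cls_homot; rewrite ?concat0 ?concat1//.
  - by apply: concat_continuous; rewrite // !concat0 concat1 IB1 B0.
  - by apply: concat_continuous; rewrite // !concat0 concat1 IB1 B0.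
  - apply: homot_concat; rewrite ?concat0 ?concat1 ?IB1//; first exact:
    homot_refl.
    by apply: homot_concatA; rewrite // B1.
have -> : cls (concat (concat (concat A p) (inv_path B))
    (concat B (concat q (inv_path C)))) =
  cls (concat (concat A p) (concat (inv_path B) (concat B (concat q (inv_path
    C))))).
  apply: cls_homot; rewrite ?concat0 ?concat1//.
  - by apply: concat_continuous; rewrite // !concat0 concat1 IB1 B0.
  - by apply: concat_continuous; rewrite // !concat0 concat1 IB0.
  - by apply: homot_concatA; rewrite ?concat0 ?concat1 ?IB0 ?IB1 ?B0.
have -> : cls (concat (concat A p)
    (concat (inv_path B) (concat B (concat q (inv_path C))))) =
  cls (concat (concat A p) (concat q (inv_path C))).
  apply: cls_homot; rewrite ?concat0 ?concat1//.
  - by apply: concat_continuous; rewrite // !concat0 concat1 IB0.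
  - apply: homot_concat; rewrite ?concat0 ?concat1 ?IB0//; first exact:
    homot_refl.
    by apply: homot_cancel; rewrite ?concat0 ?B1.
have -> : cls (concat (concat A p) (concat q (inv_path C))) =
    cls (concat (concat (concat A p) q) (inv_path C)).
  symmetry; apply: cls_homot; rewrite ?concat0 ?concat1//.
  - by apply: concat_continuous; rewrite // concat1 IC0.
  - by apply: homot_concatA; rewrite ?concat0 ?concat1 ?IC0.
symmetry; apply: cls_homot; rewrite ?concat0 ?concat1//.
- by apply: concat_continuous; rewrite // concat1 IC0.
- apply: concat_continuous; rewrite // ?concat1 ?IC0//.
  by apply: concat_continuous; rewrite // concat0.
- apply: homot_concat; rewrite ?concat0 ?concat1 ?IC0//; last exact: homot_refl.
  by apply: homot_concatA.
Qed.

Variables (f : X -> X) (alpha : R -> X) (phi : {multiplicative G -> G}).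
Hypothesis cf : continuous f.
Hypothesis indf : is_induced x0 cls f alpha phi.

Definition clamped_alpha : R -> X := alpha \o @clamp R.

Lemma clamped_alphaP : [/\ continuous clamped_alpha, clamped_alpha 0 = x0 &
  clamped_alpha 1 = f x0].
Proof.
have [[ca a0 a1] _] := indf.
by split; rewrite /clamped_alpha /= ?clamp_id ?lexx ?ler01//;
  apply: clamp_path_continuous.
Qed.

(** The value of [transport] along [alpha] followed by the image of the base path of [x], a path
    from [x0] to [f x]. *)
Definition drift (x : X) : G := (transport clamped_alpha * transport (f \o T
  x))%g.

(** The loop defining [phi (transport p)] is alpha, the f-images of a base path, of [p] and of a
    reversed base path, then alpha reversed; multiplicativity of [transport] splits it. *)
Lemma transport_induced p : continuous p ->
  (phi (transport p) * drift (p 1%R) =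
    drift (p 0%R) * transport (f \o p))%g.
Proof.
move=> cp; have homL := groupoid_hom_transport.
have [ca a0 a1] := clamped_alphaP.
have [ap indp] := indf; have [cal al0 al1] := ap.
set p' := concat (concat (T (p 0)) p) (inv_path (T (p 1))).
have cT0 := @cT (p 0); have cT1 := @cT (p 1).
have cI := inv_path_continuous cT1.
have I0 : inv_path (T (p 1)) 0 = p 1 by rewrite /inv_path subr0.
have I1 : inv_path (T (p 1)) 1 = x0 by rewrite /inv_path subrr.
have cTp : continuous (concat (T (p 0)) p) by apply: concat_continuous.
have cp' : continuous p' by apply: concat_continuous; rewrite ?concat1.
have p'0 : p' 0 = x0 by rewrite /p' !concat0 T0.
have p'1 : p' 1 = x0 by rewrite /p' concat1 I1.
have cfp : continuous (f \o p') by rewrite /comp; cont.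
have lp' : is_loop x0 p' by split=> //; exact: continuous_subspaceT.
have cIa := inv_path_continuous ca.
have Ia0 : inv_path clamped_alpha 0 = f x0 by rewrite /inv_path subr0.
have Ia1 : inv_path clamped_alpha 1 = x0 by rewrite /inv_path subrr.
have caf : continuous (concat clamped_alpha (f \o p')).
  by apply: concat_continuous; rewrite //= p'0.
set q := concat (concat clamped_alpha (f \o p')) (inv_path clamped_alpha).
have cq : continuous q by apply: concat_continuous; rewrite // concat1 /= p'1.
have phiE : phi (transport p) = transport q.
  have -> : transport p = cls p' by [].
  rewrite indp//.
  have Eq t : 0 <= t <= 1 ->
      concat (concat alpha (f \o p')) (inv_path alpha) t = q t.
    move=> t01; rewrite /q /concat /inv_path /clamped_alpha /=.
    case: ifPn => t2; first case: ifPn => t4.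
    - by rewrite clamp_id//; lra.
    - by [].
    - by rewrite clamp_id//; lra.
  have q0 : q 0 = x0 by rewrite /q !concat0.
  have q1 : q 1 = x0 by rewrite /q concat1.
  by rewrite transport_loop//; apply: cls_ext.
rewrite phiE.
rewrite (Lam_concat homL)//; last by rewrite concat1 /= p'1.
rewrite (Lam_concat homL)//; last by rewrite /= p'0.
rewrite !comp_concat !(Lam_concat homL) ?concat1/= ?T1 ?I0//; try by rewrite
  /comp; cont.
  rewrite [transport (inv_path _)](Lam_inv homL)//.
  have -> : f \o inv_path (T (p 1)) = inv_path (f \o T (p 1)) by [].
  rewrite [transport (inv_path _)](Lam_inv homL)//; last by rewrite /comp; cont.
  by rewrite /drift !mulgA !mulgVK.
by apply: concat_continuous; rewrite /comp ?T1//; cont.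
Qed.

Lemma drift_x0 : drift x0 = transport clamped_alpha.
Proof.
rewrite /drift Tx0.
have -> : f \o (fun=> x0) = (fun=> f x0) :> (R -> X) by [].
by rewrite (Lam_cst groupoid_hom_transport) mulg1.
Qed.

End transport.

Lemma exists_transport (R : realType) (X : topologicalType) (G : groupType)
    (x0 : X) (cls : (R -> X) -> G) (f : X -> X) (alpha : R -> X)
    (phi : {multiplicative G -> G}) :
  (forall x, exists p : R -> X, [/\ continuous p, p 0 = x0 & p 1 = x]) ->
  is_pi1 x0 cls -> continuous f -> is_induced x0 cls f alpha phi ->
  exists (Lam : (R -> X) -> G) (psi : X -> G) (beta : R -> X),
  [/\ groupoid_hom Lam,
      forall p : R -> X, continuous p ->
        (phi (Lam p) * psi (p 1%R) = psi (p 0%R) * Lam (f \o p))%g,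
      forall g, exists p : R -> X, [/\ continuous p, p 0 = x0, p 1 = x0 & Lam
        p = g] &
      [/\ continuous beta, beta 0 = x0, beta 1 = f x0 & psi x0 = Lam beta]].
Proof.
move=> conn pi1 cf indf.
(* The base path of [x0] is constant so that [transport] agrees with [cls] on loops. *)
have /choice[T TP] x : exists p : R -> X,
    [/\ continuous p, p 0 = x0, p 1 = x & x = x0 -> p = (fun=> x0)].
  have [->|xx0] := pselect (x = x0); last by have [p []] := conn x; exists p.
  by exists (fun=> x0); split=> //; apply: cst_continuous.
have cT x : continuous (T x) by have [] := TP x.
have T0 x : T x 0 = x0 by have [] := TP x.
have T1 x : T x 1 = x by have [] := TP x.
have Tx0 : T x0 = (fun=> x0) by have [_ _ _] := TP x0; apply.
exists (transport cls T), (drift cls T f alpha), (alpha \o @clamp R); split.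
- exact: (groupoid_hom_transport pi1 cT T0 T1).
- by move=> p; apply: (transport_induced pi1 cT T0 T1 Tx0 cf indf).
- move=> g; have [_ _ /(_ g)[p [cp p0 p1] pg]] := pi1.
  exists (p \o @clamp R).
  have cpc := clamp_path_continuous cp.
  have pc0 : (p \o @clamp R) 0 = x0 by rewrite /= clamp_id ?lexx ?ler01.
  have pc1 : (p \o @clamp R) 1 = x0 by rewrite /= clamp_id ?lexx ?ler01.
  split=> //; rewrite (transport_loop pi1 Tx0)// -pg; symmetry.
  by apply: (cls_ext pi1) => // t t01; rewrite /= clamp_id.
- have [cb b0 b1] := clamped_alphaP indf.
  by split=> //; apply: (drift_x0 pi1 cT T0 T1 Tx0).
Qed.
(** * Surfaces *)

Section nice_neighborhoods.
Context {R : realType}.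
Implicit Types S : topologicalType.

(** The homotopies may leave [U]: all that is wanted is that groupoid morphisms depend only on the
    endpoints of paths in [U]. *)
Definition nice S (U : set S) : Prop := [/\ open U,
  forall s s', U s -> U s' -> exists p : R -> S,
    [/\ continuous p, forall t, U (p t), p 0 = s & p 1 = s'] &
  forall p q : R -> S, continuous p -> continuous q -> (forall t, U (p t)) ->
    (forall t, U (q t)) -> p 0 = q 0 -> p 1 = q 1 -> homot p q].

Definition locally_nice S : Prop :=
  forall (s : S) (W : set S), nbhs s W -> exists U, [/\ nice U, U s & U `<=` W].

Lemma segment_lt (l a b s : R) : l < a -> l < b -> 0 <= s <= 1 ->
  l < a + s * (b - a).
Proof.
move=> la lb /andP[s0 s1].
have -> : a + s * (b - a) = l + (1 - s) * (a - l) + s * (b - l) by ring.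
have [->|s0'] := eqVneq s 0; first by lra.
have : 0 < s * (b - l) by rewrite mulr_gt0 ?subr_gt0// lt_neqAle eq_sym s0'.
have : 0 <= (1 - s) * (a - l) by rewrite mulr_ge0 ?subr_ge0// ltW.
lra.
Qed.

Lemma segment_gt (u a b s : R) : a < u -> b < u -> 0 <= s <= 1 ->
  a + s * (b - a) < u.
Proof.
move=> au bu s01; have := @segment_lt (- u) (- a) (- b) s.
rewrite !ltrN2 => /(_ au bu s01); lra.
Qed.

Lemma segment_ge0 (a b s : R) : 0 <= a -> 0 <= b -> 0 <= s <= 1 ->
  0 <= a + s * (b - a).
Proof.
move=> a0 b0 /andP[s0 s1]; have -> : a + s * (b - a) = (1 - s) * a + s * b by
  ring.
by rewrite addr_ge0 ?mulr_ge0 ?subr_ge0.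
Qed.

Lemma segment_ball (c : R) (e : R) (a b s : R) : ball c e a -> ball c e b ->
  0 <= s <= 1 -> ball c e (a + s * (b - a)).
Proof.
rewrite /ball /= /ball_ => ca cb s01.
have {}ca : c - e < a < c + e by move: ca; rewrite ltr_norml; lra.
have {}cb : c - e < b < c + e by move: cb; rewrite ltr_norml; lra.
move: ca cb => /andP[a1 a2] /andP[b1 b2].
have := segment_lt a1 b1 s01; have := segment_gt a2 b2 s01.
by rewrite ltr_norml; lra.
Qed.

Lemma segment_half_disc (z w w' : R * R) (e s : R) (D := ball z e `&`
  @half_plane R) :
  D w -> D w' -> 0 <= s <= 1 ->
  D (w.1 + s * (w'.1 - w.1), w.2 + s * (w'.2 - w.2)).
Proof.
move=> [[/= a1 a2] /= a3] [[/= b1 b2] /= b3] s01; split=> /=.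
  by split=> /=; apply: segment_ball.
exact: segment_ge0.
Qed.

(** Small balls of a chart, cut by the half plane, are convex; segments and straight-line homotopies
    are carried back by the inverse chart [g]. *)
Lemma surface_locally_nice S : is_surface R S -> locally_nice S.
Proof.
move=> [_ _ charts] s W Ws.
have [U [h [[oU [V oV hU] ch [g cg gh]] Us]]] := charts s.
pose z := h s.
have hUz : (h @` U) z by exists s.
have [Vz _] : (V `&` @half_plane R) z by rewrite -hU.
have gW : \forall w \near z, (h @` U) w -> W (g w).
  have gz : nbhs (g z) W by rewrite /z gh.
  by have /subspace_continuousP/(_ z hUz W gz) := cg.
have VW : \forall w \near z, V w /\ ((h @` U) w -> W (g w)).
  by near=> w; split; [near: w; exact: open_nbhs_nbhs | near: w].
have /nbhs_ballP[e /= e0 VWe] := VW.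
pose D := ball z e `&` @half_plane R.
have DU : D `<=` h @` U by move=> w [we whalf]; rewrite hU; split=> //; have
  [] := VWe _ we.
have Dg w : D w -> U (g w) /\ h (g w) = w.
  by move=> /DU[x Ux <-]; rewrite gh.
have cgD : {within D, continuous g} by apply: continuous_subspaceW cg.
have oU' : open (U `&` (h @^-1` ball z e)).
  rewrite openE => x [Ux hx]; rewrite /interior.
  have h1 : \forall y \near x, U y -> ball z e (h y).
    have zx : nbhs (h x) (ball z e) by apply: open_nbhs_nbhs; split=> //;
      apply: ball_open.
    by have /subspace_continuousP/(_ x Ux _ zx) := ch.
  have h2 : \forall y \near x, U y by apply: open_nbhs_nbhs.
  by near=> y; have Uy : U y by [near: y]; split=> //; apply: (near h1 y).
have U'D x : U x -> ball z e (h x) -> D (h x).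
  move=> Ux zx; split=> //.
  by have [] : (V `&` @half_plane R) (h x) by rewrite -hU; exists x.
exists (U `&` (h @^-1` ball z e)); split; first split=> //.
- move=> x y [Ux hx] [Uy hy].
  pose L := fun t : R => ((h x).1 + clamp t * ((h y).1 - (h x).1),
    (h x).2 + clamp t * ((h y).2 - (h x).2)).
  have LD t : D (L t) by apply: segment_half_disc; [exact: U'D|exact:
    U'D|exact: clamp_itv].
  exists (g \o L); split.
  + apply: within_continuous_comp cgD _ LD.
    have ? : continuous (@clamp R) := @clamp_continuous R.
    by rewrite /L; cont.
  + move=> t /=; have [UgL hgL] := Dg _ (LD t); split=> //=.
    by rewrite hgL; case: (LD t).
  + rewrite /L /= clamp_id ?lexx ?ler01// !mul0r !addr0 -surjective_pairing.
    exact: gh.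
  + rewrite /L /= clamp_id ?lexx ?ler01// !mul1r.
    by rewrite ![_ + (_ - _)]addrC !subrK -surjective_pairing; apply: gh.
- move=> p q cp cq Up Uq p0 p1.
  have chp (r : R -> S) : continuous r -> (forall t, (U `&` (h @^-1` ball z
    e)) (r t)) ->
      continuous (fun t => h (r t)).
    by move=> cr Ur; apply: (within_continuous_comp ch cr) => t; case: (Ur t).
  have rE (r : R -> S) : (forall t, (U `&` (h @^-1` ball z e)) (r t)) ->
      r = (fun t => g ((h (r t)).1, (h (r t)).2)).
    move=> Ur; apply/funext => t; rewrite -surjective_pairing gh//.
    by case: (Ur t).
  rewrite (rE p Up) (rE q Uq).
  have hp := chp p cp Up; have hq := chp q cq Uq.
  apply: (@homot_segments R S D g (fun t => (h (p t)).1) (fun t => (h (p t)).2)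
    (fun t => (h (q t)).1) (fun t => (h (q t)).2)) => //.
  + by move=> w w' t Dw Dw' t01; apply: segment_half_disc.
  + by apply: (@comp_continuous _ _ _ fst (fun t => h (p t))) => //; apply:
    fst_continuous.
  + by apply: (@comp_continuous _ _ _ snd (fun t => h (p t))) => //; apply:
    snd_continuous.
  + by apply: (@comp_continuous _ _ _ fst (fun t => h (q t))) => //; apply:
    fst_continuous.
  + by apply: (@comp_continuous _ _ _ snd (fun t => h (q t))) => //; apply:
    snd_continuous.
  + by move=> t; rewrite -surjective_pairing; have [Ut zt] := Up t; apply: U'D.
  + by move=> t; rewrite -surjective_pairing; have [Ut zt] := Uq t; apply: U'D.
  + by rewrite p0.
  + by rewrite p0.
  + by rewrite p1.
  + by rewrite p1.
- by split=> //=; apply: ballxx.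
- move=> x [Ux zx]; rewrite -(gh x Ux); have [_] := VWe _ zx; apply.
  by exists x.
Unshelve. all: by end_near. Qed.

Lemma connected_propagate S (P : S -> Prop) (a b : S) : connected [set: S] ->
  (forall x, \forall y \near x, P y <-> P x) -> P a -> P b.
Proof.
move=> conS step Pa; suff PT : P = setT by rewrite PT.
apply: conS.
- by exists a.
- exists P; rewrite ?setTI// openE => x Px.
  by apply: filterS (step x) => y [_]; apply.
- exists P; rewrite ?setTI// -openC openE => x nPx.
  by apply: filterS (step x) => y [h _] /h.
Qed.

Lemma locally_nice_path_connected S (s s' : S) : locally_nice S ->
  connected [set: S] -> exists p : R -> S, [/\ continuous p, p 0 = s & p 1 =
    s'].
Proof.
move=> lnS conS.
pose E := [set x : S | exists p : R -> S, [/\ continuous p, p 0 = s & p 1 = x]].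
have cat x y : E x -> (exists p : R -> S, [/\ continuous p, p 0 = x & p 1 =
  y]) -> E y.
  move=> [p [cp p0 p1]] [q [cq q0 q1]]; exists (concat p q); split.
  - by apply: concat_continuous; rewrite // p1.
  - by rewrite concat0.
  - by rewrite concat1.
have step x : \forall y \near x, E y <-> E x.
  have [U [[oU Uc _] Ux _]] := lnS x setT filterT.
  have := open_nbhs_nbhs (conj oU Ux).
  apply: filterS => y Uy; split=> Ex; apply: cat Ex _.
    by have [p [? _ ? ?]] := Uc y x Uy Ux; exists p.
  by have [p [? _ ? ?]] := Uc x y Ux Uy; exists p.
suff : E s' by [].
apply: (@connected_propagate S E s s' conS step).
by exists (fun=> s); split=> //; exact: cst_continuous.
Qed.

End nice_neighborhoods.

(** * Path-independent transport in small open sets *)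

Section local_transport.
Context {R : realType} {S : topologicalType} {G : groupType}.
Variables (Lam : (R -> S) -> G).
Hypothesis homL : groupoid_hom Lam.
Hypothesis lnS : @locally_nice R S.
Implicit Types (U V : set S) (p q : R -> S).
Local Notation nice := (@nice R S).

(* Meaningful only if s and s' are joined in U (the value is 1 otherwise).    *)
Definition tr U (s s' : S) : G :=
  if pselect (exists p, [/\ continuous p, forall t, U (p t), p 0 = s & p 1 =
    s'])
    is left ex then Lam (projT1 (cid ex)) else 1%g.

Lemma tr_path U p : nice U -> continuous p ->
  (forall t, 0 <= t <= 1 -> U (p t)) -> Lam p = tr U (p 0) (p 1).
Proof.
move=> [_ _ Uh] cp Up.
have cpc : continuous (p \o @clamp R).
  by have ? : continuous (@clamp R) := @clamp_continuous R; rewrite /comp; cont.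
have pc0 : (p \o @clamp R) 0 = p 0 by rewrite /= clamp_id ?lexx ?ler01.
have pc1 : (p \o @clamp R) 1 = p 1 by rewrite /= clamp_id ?lexx ?ler01.
have Upc t : U ((p \o @clamp R) t) by apply: Up; exact: clamp_itv.
have -> : Lam p = Lam (p \o @clamp R).
  apply: (Lam_homot homL) => //; apply: homot_ext (homot_refl cp) _ _ => // t
    t01.
  by rewrite /= clamp_id.
rewrite /tr; case: pselect => [ex|[]]; last by exists (p \o @clamp R).
have [cq Uq q0 q1] := projT2 (cid ex); apply: (Lam_homot homL) => //.
by apply: Uh; rewrite // ?q0 ?q1.
Qed.

Lemma tr_ex U s s' : nice U -> U s -> U s' ->
  exists p, [/\ continuous p, forall t, U (p t), p 0 = s, p 1 = s' & Lam p =
    tr U s s'].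
Proof.
move=> nU Us Us'; have [_ Uc _] := nU.
have [p [cp Up p0 p1]] := Uc s s' Us Us'.
by exists p; split=> //; rewrite (tr_path nU)// p0 p1.
Qed.

Lemma trM U s s' s'' : nice U -> U s -> U s' -> U s'' ->
  (tr U s s' * tr U s' s'')%g = tr U s s''.
Proof.
move=> nU Us Us' Us''.
have [p [cp Up p0 p1 <-]] := tr_ex nU Us Us'.
have [q [cq Uq q0 q1 <-]] := tr_ex nU Us' Us''.
rewrite -(Lam_concat homL) ?p1// (tr_path nU) ?concat0 ?concat1 ?p0 ?q1//.
  by apply: concat_continuous; rewrite // p1.
by move=> t _; rewrite /concat; case: ifP.
Qed.

Lemma tr_id U s : nice U -> U s -> tr U s s = 1%g.
Proof. by move=> nU Us; apply: (mulgI (tr U s s)); rewrite trM// mulg1. Qed.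

Lemma trV U s s' : nice U -> U s -> U s' -> (tr U s s')^-1%g = tr U s' s.
Proof.
by move=> nU Us Us'; apply: (mulgI (tr U s s')); rewrite mulgV trM// tr_id.
Qed.

Lemma tr_sub U V s s' : nice U -> nice V -> V `<=` U -> V s -> V s' ->
  tr U s s' = tr V s s'.
Proof.
move=> nU nV VU Vs Vs'; have [p [cp Vp p0 p1 <-]] := tr_ex nV Vs Vs'.
by rewrite (tr_path nU) ?p0 ?p1// => t _; apply: VU.
Qed.

(** Both transports can be computed in a nice neighborhood of [s] inside the intersection, which
    itself need not be nice. *)
Lemma tr_near U V s : nice U -> nice V -> U s -> V s ->
  \forall s' \near s, [/\ U s', V s' & tr U s s' = tr V s s'].
Proof.
move=> nU nV Us Vs; have [oU _ _] := nU; have [oV _ _] := nV.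
have nW : nbhs s (U `&` V).
  by apply: open_nbhs_nbhs; split=> //; apply: openI.
have [W [nW' Ws WUV]] := lnS nW; have [oW _ _] := nW'.
have := open_nbhs_nbhs (conj oW Ws); apply: filterS => s' Ws'.
have [Us' Vs'] := WUV _ Ws'; split=> //.
rewrite (tr_sub nU nW')//; last by move=> x /WUV[].
by rewrite (tr_sub nV nW')// => x /WUV[].
Qed.

Lemma tr_near_comp (Y : topologicalType) (F : Y -> S) U V (y : Y) :
  continuous F -> nice U -> nice V -> U (F y) -> V (F y) ->
  \forall y' \near y,
    [/\ U (F y'), V (F y') & tr U (F y) (F y') = tr V (F y) (F y')].
Proof. by move=> cF nU nV Uy Vy; have := cF y _ (tr_near nU nV Uy Vy). Qed.

(* Nearby paths differ by short paths at their ends.  The set of the times s  *)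
(* such that this holds for the restrictions to [0, s] is open and closed.    *)
Lemma tr_family (Y : topologicalType) (F : Y * R -> S) (y0 : Y) U0 U1 :
  continuous F -> nice U0 -> nice U1 -> U0 (F (y0, 0)) -> U1 (F (y0, 1)) ->
  \forall y \near y0,
    (Lam (fun t => F (y0, t)) * tr U1 (F (y0, 1%R)) (F (y, 1%R)))%g =
    (tr U0 (F (y0, 0%R)) (F (y, 0%R)) * Lam (fun t => F (y, t)))%g.
Proof.
move=> cF nU0 nU1 U00 U11.
have cFy y : continuous (fun t => F (y, t)) by cont.
have cFs s : continuous (fun y => F (y, s)) by cont.
pose P y a b := Lam (subpath (fun t => F (y, t)) a b).
pose Z (s : R) := forall U, nice U -> U (F (y0, s)) -> \forall y \near y0,
  (P y0 0%R s * tr U (F (y0, s)) (F (y, s)))%g =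
  (tr U0 (F (y0, 0%R)) (F (y, 0%R)) * P y 0%R s)%g.
suff : Z 1.
  move=> /(_ U1 nU1 U11); apply: filterS => y.
  by rewrite /P !subpath01.
have conR : connected [set: R] by apply/connected_intervalP.
apply: (@connected_propagate _ Z 0 1 conR) => [s|]; last first.
  move=> U nU UF; have := tr_near_comp (cFs 0) nU nU0 UF U00.
  apply: filterS => y [_ _ ->].
  by rewrite /P !(Lam_subpath_id homL) mul1g mulg1.
have [U [nU Us _]] := lnS (filterT : nbhs (F (y0, s)) setT).
have [oU _ _] := nU.
have /cF[[N I] [/= NN NI] NIU] := open_nbhs_nbhs (conj oU Us).
have /nbhs_ballP[e /= e0 eI] := NI.
(* The box [N] times the ball is mapped into a single nice [U], where the piece from [s1] to [s2]
   depends only on its ends. *)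
have move_s s1 s2 : ball s e s1 -> ball s e s2 -> Z s1 -> Z s2.
  move=> s1e s2e Zs1 V nV Vs2.
  have UF y t : N y -> ball s e t -> U (F (y, t)).
    by move=> Ny st; apply: (NIU (y, t)); split=> //; apply: eI.
  have Ny0 : N y0 by apply: nbhs_singleton.
  have h1 := tr_near_comp (cFs s2) nV nU Vs2 (UF _ _ Ny0 s2e).
  have h2 := Zs1 U nU (UF _ _ Ny0 s1e).
  near=> y.
  have Ny : N y by near: y.
  have [_ _ ->] : [/\ V (F (y, s2)), U (F (y, s2)) &
    tr V (F (y0, s2)) (F (y, s2)) = tr U (F (y0, s2)) (F (y, s2))] by near: y.
  have E : (P y0 0%R s1 * tr U (F (y0, s1)) (F (y, s1)))%g =
    (tr U0 (F (y0, 0%R)) (F (y, 0%R)) * P y 0%R s1)%g by near: y.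
  have Pin y' : N y' -> P y' s1 s2 = tr U (F (y', s1)) (F (y', s2)).
    move=> Ny'; rewrite /P (tr_path nU) ?subpath0 ?subpath1//.
      exact: subpath_continuous.
    move=> t t01; apply: UF => //; rewrite mulrC; exact: segment_ball.
  rewrite /P -(Lam_subpath homL 0 s1 s2 (cFy y0)) -(Lam_subpath homL 0 s1 s2
    (cFy y)).
  rewrite -![Lam _]/(P _ _ _) !Pin// mulgA -E -!mulgA !(trM nU)//; exact: UF.
have : nbhs s (ball s e) by apply: nbhsx_ballx.
apply: filterS => s' ss'; split; apply: move_s => //; exact: ballxx.
Unshelve. all: by end_near. Qed.

End local_transport.
(** * Growth of words along orbits *)

Lemma near_seq (T : topologicalType) (I : eqType) (s : seq I) (x : T)
    (P : I -> T -> Prop) : (forall i, i \in s -> \forall y \near x, P i y) ->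
  \forall y \near x, forall i, i \in s -> P i y.
Proof.
elim: s => [|i s IHs] sP; first by apply: filterE.
have h1 := sP i (mem_head _ _).
have h2 : \forall y \near x, forall j, j \in s -> P j y.
  by apply: IHs => j js; apply: sP; rewrite inE js orbT.
near=> y => j; rewrite inE => /orP[/eqP ->|]; first by near: y.
by move: j; near: y.
Unshelve. all: by end_near. Qed.

(** Compactness along the filter of finite lists ordered by inclusion, so that finitely many local
    lists merge into one. *)
Lemma compact_seq (T : topologicalType) (I : eqType) (K : set T)
    (P : seq I -> T -> Prop) : compact K ->
  (forall (s1 s2 : seq I) t, {subset s1 <= s2} -> P s1 t -> P s2 t) ->
  (forall t, K t -> exists s, \forall t' \near t, P s t') ->
  exists s, forall t, K t -> P s t.
Proof.
move=> /compact_near_coveringP cK Pmono Ploc.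
pose F : set_system (seq I) := [set B | exists s0 : seq I,
  forall s : seq I, {subset s0 <= s} -> B s].
have FF : Filter F.
  split; first by exists [::].
  - move=> B B' [s sB] [s' sB']; exists (s ++ s') => s'' ss''.
    split; [apply: sB|apply: sB'] => i is'; apply: ss'';
      by rewrite mem_cat is' ?orbT.
  - by move=> B B' BB' [s sB]; exists s => s' /sB /BB'.
have [|s sP] := cK _ F P FF; last by exists s; apply: sP.
move=> t Kt; have [s sP] := Ploc t Kt.
exists ([set t' | P s t'], [set s' : seq I | {subset s <= s'}]).
  by split=> //=; exists s.
by move=> [t' s'] /= [Pt' ss']; apply: Pmono Pt'.
Qed.

(** * Functions with bounded jumps *)

Section discrete_intermediate_value.
Context {R : realType}.

(** If [[c, c + M)] were skipped, no jump of size at most [M] could cross it, and [r t < c] would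
    propagate from 0 to 1. *)
Lemma discrete_ivt (r : R -> nat) (M c : nat) : (0 < M)%N -> r 0 = 0%N ->
  (forall t, \forall t' \near t, (r t' <= r t + M)%N /\ (r t <= r t' + M)%N) ->
  (c <= r 1%R)%N -> exists t, (c <= r t < c + M)%N.
Proof.
move=> M0 r0 rM cr; apply: contrapT => nex.
have gap t : (r t < c)%N \/ (c + M <= r t)%N.
  case: (ltnP (r t) c) => [|ct]; first by left.
  by right; rewrite leqNgt; apply/negP => tM; apply: nex; exists t; rewrite ct.
have c0 : (0 < c)%N by have [] := gap 0; rewrite r0//; lia.
have conR : connected [set: R] by apply/connected_intervalP.
suff : (r 1%R < c)%N by rewrite ltnNge cr.
apply: (@connected_propagate _ (fun t => (r t < c)%N) 0 1 conR) => [t|].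
  apply: filterS (rM t) => t' [h1 h2].
  by have := gap t; have := gap t'; split; lia.
by rewrite r0.
Qed.

(* A function with jumps at most M takes a value in each of the intervals     *)
(* [j M, (j + 1) M) up to its value at 1.                                     *)
Lemma jumps_le_card (T : Type) (eta : R -> T) (d : T -> nat) (J : finType)
    (key : R -> J) (M : nat) : (0 < M)%N -> d (eta 0) = 0%N ->
  (forall t t', key t = key t' -> eta t = eta t') ->
  (forall t, \forall t' \near t,
     (d (eta t') <= d (eta t) + M)%N /\ (d (eta t) <= d (eta t') + M)%N) ->
  (d (eta 1%R) <= M * #|J|)%N.
Proof.
move=> M0 d0 keyP dM.
pose n := (d (eta 1%R) %/ M).+1.
have /choice[t tP] (j : 'I_n) : exists t, (j * M <= d (eta t) < j * M + M)%N.
  apply: (@discrete_ivt (d \o eta)) => //=.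
  by rewrite (leq_trans _ (leq_trunc_div (d (eta 1%R)) M))// leq_mul2r -ltnS
    ltn_ord orbT.
have keyI : injective (key \o t).
  move=> i j /= /keyP tE; apply/val_inj => /=.
  have divE (l : 'I_n) : (d (eta (t l)) %/ M)%N = l.
    have /andP[h1 h2] := tP l.
    have -> : d (eta (t l)) = (l * M + (d (eta (t l)) - l * M))%N by lia.
    by rewrite divnMDl// divn_small ?addn0//; lia.
  by rewrite -divE tE divE.
have := leq_card _ keyI; rewrite card_ord /n ltn_divLR//; lia.
Qed.

End discrete_intermediate_value.

(* [K] is a homotopy from k \o g to the identity; [psi x] relates the base    *)
(* path of f x to the image by f of the base path of x.                       *)
Section word_growth.
Context {R : realType} {X S : topologicalType} {G : groupType}.
Variables (g : X -> S) (k : S -> X) (K : X * R -> X).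
Hypotheses (cg : continuous g) (ck : continuous k) (cK : continuous K).
Hypotheses (K0 : forall x, K (x, 0) = k (g x)) (K1 : forall x, K (x, 1) = x).
Variables (Lam : (R -> X) -> G) (f : X -> X) (phi : {multiplicative G -> G}).
Variable psi : X -> G.
Hypothesis homL : groupoid_hom Lam.
Hypothesis cf : continuous f.
Hypothesis lnS : @locally_nice R S.
Hypothesis phiL : forall p : R -> X, continuous p ->
  (phi (Lam p) * psi (p 1%R) = psi (p 0%R) * Lam (f \o p))%g.
Local Notation nice := (@nice R S).
Implicit Types (p : R -> X) (x : X) (a b s : S) (U V : set S).

Definition LamS (q : R -> S) : G := Lam (k \o q).

Let homLS : groupoid_hom LamS := groupoid_hom_comp ck homL.
Local Notation tr := (tr LamS).

Definition kap x : G := Lam (fun t => K (x, t)).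

(** The naturality square of the homotopy [K] along [p]. *)
Lemma LamE p : continuous p ->
  Lam p = ((kap (p 0%R))^-1 * LamS (g \o p) * kap (p 1%R))%g.
Proof.
move=> cp; have := @Lam_square R X G Lam homL (fun z => K (p z.1, z.2)).
rewrite /=; have -> : (fun t => K (p t, 0)) = k \o (g \o p).
  by apply/funext => t; rewrite K0.
have -> : (fun t => K (p t, 1)) = p by apply/funext => t; rewrite K1.
have cH : continuous (fun z : R * R => K (p z.1, z.2)) by cont.
by move=> /(_ cH) E; rewrite -mulgA -/(LamS _) E mulgA mulVg mul1g.
Qed.

(* The value of Lam at the path which follows k along a path of U from a to   *)
(* g x, and then K (x, _).                                                    *)
Definition theta U a x : G := (tr U a (g x) * kap x)%g.

Lemma theta_flat U a p t : nice U -> U a -> continuous p -> U (g (p t)) ->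
  \forall t' \near t, U (g (p t')) /\
    Lam (subpath p t t') = ((theta U a (p t))^-1 * theta U a (p t'))%g.
Proof.
move=> nU Ua cp Ut; have [oU _ _] := nU.
have cgp : continuous (fun t => g (p t)) by cont.
have /cgp/nbhs_ballP[e /= e0 eU] := open_nbhs_nbhs (conj oU Ut).
have : nbhs t (ball t e) by apply: nbhsx_ballx.
apply: filterS => t' tt'; split; first exact: eU.
have csub := @subpath_continuous R X p t t' cp.
have cgs : continuous (g \o subpath p t t') by rewrite /comp; cont.
rewrite LamE// subpath0 subpath1 (tr_path homLS nU cgs) /=; last first.
  move=> s s01; apply: eU; rewrite /= mulrC; apply: segment_ball => //.
  exact: ballxx.
rewrite subpath0 subpath1 /theta invgM -(trM homLS nU Ut Ua (eU _ tt')).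
by rewrite -(trV homLS nU Ua Ut) !mulgA.
Qed.

(** The lift of f read in the sheets over [U] and [V]: by [angS], the factor by which it changes the
    recorded translate at [x]. *)
Definition tcoef U V a b x : G :=
  (phi (theta U a x) * psi x * (theta V b (f x))^-1)%g.

(** Nearby points of X need not be joined by a short path, so the comparison goes through S: [g x]
    and [g y] are joined there, and the tracks of [K], pushed by [f] and [g], form a family of paths
    to which [tr_family] applies. *)
Lemma tcoef_near U V a b x : nice U -> nice V -> U a -> V b ->
  U (g x) -> V (g (f x)) ->
  \forall y \near x, tcoef U V a b y = tcoef U V a b x.
Proof.
move=> nU nV Ua Vb Ux Vfx; have [oU _ _] := nU; have [oV _ _] := nV.
pose q s := g (f (k s)).
have cq : continuous q by rewrite /q; cont.
have cgf : continuous (fun x => g (f x)) by cont.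
have [M [nM Mq _]] := lnS (filterT : nbhs (q (g x)) setT).
have [oM _ _] := nM.
have nW : nbhs (g x) (q @^-1` M `&` U).
  apply: filterI; last exact: open_nbhs_nbhs.
  by apply: cq; exact: open_nbhs_nbhs.
have [N [nN Nx NW]] := lnS nW; have [oN _ _] := nN.
pose F (z : X * R) : S := g (f (K z)).
have cF : continuous F by rewrite /F; cont.
have F0 y : F (y, 0) = q (g y) by rewrite /F K0.
have F1 y : F (y, 1) = g (f y) by rewrite /F K1.
(* The coefficient at [y] once everything depending on [y] has cancelled. *)
pose C := (phi (tr U a (g x)) * psi (k (g x)) * (kap (f (k (g x))))^-1 *
  LamS (fun t => F (x, t)) * tr V (g (f x)) b)%g.
suff near_C : \forall y \near x, tcoef U V a b y = C.
  have xC := nbhs_singleton near_C.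
  by apply: filterS near_C => y ->.
have h1 : \forall y \near x, N (g y) by apply: cg; exact: open_nbhs_nbhs.
have h2 : \forall y \near x, V (g (f y)) by apply: cgf; exact: open_nbhs_nbhs.
have h3 := @tr_family R S G LamS homLS lnS X F x M V cF nM nV.
rewrite F0 F1 in h3; have {}h3 := h3 Mq Vfx.
near=> y.
have Ny : N (g y) by near: y.
have Vfy : V (g (f y)) by near: y.
have : (LamS (fun t => F (x, t)) * tr V (g (f x)) (F (y, 1%R)))%g =
  (tr M (q (g x)) (F (y, 0%R)) * LamS (fun t => F (y, t)))%g by near: y.
rewrite F0 F1 => E.
have [p [cp Np p0 p1 LpE]] := tr_ex homLS nN Nx Ny.
have [[_ Uy] _] := (NW _ Ny, NW _ Nx).
have trE : tr U a (g y) = (tr U a (g x) * Lam (k \o p))%g.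
  rewrite -[Lam _]/(LamS p) LpE -(tr_sub homLS nU nN)//.
    by rewrite (trM homLS nU).
  by move=> z /NW[].
have cKy : continuous (fun t => K (y, t)) by cont.
have ckp : continuous (k \o p) by rewrite /comp; cont.
have e1 : (phi (kap y) * psi y = psi (k (g y)) * Lam (f \o (fun t => K (y,
  t))))%g.
  by have := phiL cKy; rewrite K0 K1.
have e2 : (phi (Lam (k \o p)) * psi (k (g y)) =
    psi (k (g x)) * Lam (f \o (k \o p)))%g.
  by have := phiL ckp; rewrite /= p0 p1.
have e3 : Lam (f \o (k \o p)) = ((kap (f (k (g x))))^-1 *
    tr M (q (g x)) (q (g y)) * kap (f (k (g y))))%g.
  rewrite LamE/=; last by rewrite /comp; cont.
  rewrite (tr_path homLS nM)/= ?p0 ?p1//; first by rewrite /comp; cont.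
  by move=> t _; have [/= ? _] := NW _ (Np t).
have e4 : Lam (f \o (fun t => K (y, t))) = ((kap (f (k (g y))))^-1 *
    LamS (fun t => F (y, t)) * kap (f y))%g.
  rewrite LamE/=; last by rewrite /comp; cont.
  by rewrite K0 K1.
rewrite /tcoef /theta trE !gmulfM -!mulgA.
rewrite [(phi (kap y) * _)%g]mulgA e1 -!mulgA.
rewrite [(phi (Lam _) * _)%g]mulgA e2 e3 e4 invgM -!mulgA.
rewrite [(kap (f (k (g y))) * _)%g]mulgA mulgV mul1g.
rewrite [(kap (f y) * _)%g]mulgA mulgV mul1g.
rewrite /C -!mulgA (trV homLS nV Vb Vfy).
rewrite -(trM homLS nV Vfx Vfy Vb).
by rewrite [(LamS _ * (tr V _ _ * _))%g]mulgA E -!mulgA.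
Unshelve. all: by end_near. Qed.

(* There are two neighborhoods of each center because a point of the closure  *)
(* of QQ a must still have a coordinate with respect to a.                    *)
Variables (UU QQ : S -> set S) (cs : seq S).
Hypotheses (nUU : forall a, nice (UU a)) (UUa : forall a, UU a a).
Hypotheses (oQQ : forall a, open (QQ a)) (clQ : forall a, closure (QQ a) `<=`
  UU a).
Hypothesis csP : forall s, exists a, a \in cs /\ QQ a s.
Hypothesis cS : compact [set: S].

Definition th a x : G := theta (UU a) a x.

Let QU a s : QQ a s -> UU a s.
Proof. by move=> Qs; apply: clQ; apply: subset_closure. Qed.

(** Either the coordinate for [a] exists at [t], or conditions assuming [QQ a] are vacuous near [t];
    the local finiteness arguments below use this dichotomy. *)
Lemma QQ_near (T : topologicalType) (F : T -> S) a t : continuous F ->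
  UU a (F t) \/ \forall t' \near t, ~ QQ a (F t').
Proof.
move=> cF; have [Ut|nUt] := pselect (UU a (F t)); [by left|right].
have oC : open (~` closure (QQ a)).
  by rewrite openC; exact: closed_closure.
have Ft : nbhs (F t) (~` closure (QQ a)).
  by apply: open_nbhs_nbhs; split=> // /clQ.
have h : \forall t' \near t, (~` closure (QQ a)) (F t') := cF t _ Ft.
apply: filterS h => t' nQ Qs.
by apply: nQ; exact: subset_closure.
Qed.

(* The translate of the sheet over UU a in which the lift of p is at time t.  *)
Definition ang p a t : G := (Lam (subpath p 0 t) * (th a (p t))^-1)%g.

Lemma ang_near p a t : continuous p -> UU a (g (p t)) ->
  \forall t' \near t, UU a (g (p t')) /\ ang p a t' = ang p a t.
Proof.
move=> cp Ut; have := theta_flat (nUU a) (UUa a) cp Ut.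
apply: filterS => t' [Ut' E]; split=> //.
by rewrite /ang -(Lam_subpath homL 0 t t' cp) E /th mulgA mulgK.
Qed.

Lemma ang_finite p : continuous p -> exists F0 : seq G, forall t, 0 <= t <= 1 ->
  forall a, a \in cs -> QQ a (g (p t)) -> ang p a t \in F0.
Proof.
move=> cp; have cgp : continuous (fun t => g (p t)) by cont.
have cI : compact (`[0%R, 1%R]%classic : set R) by exact: segment_compact.
have [|t _|F0 F0P] := @compact_seq R G _ (fun F0 t => forall a, a \in cs ->
    QQ a (g (p t)) -> ang p a t \in F0) cI.
- by move=> s1 s2 t s12 s1P a acs Qa; apply/s12/s1P.
- exists [seq ang p a t | a <- cs]; apply: near_seq => a acs.
  have [Ut|nQ] := @QQ_near _ _ a t cgp; last by apply: filterS nQ.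
  apply: filterS (ang_near cp Ut) => t' [_ ->] _.
  exact: map_f.
by exists F0 => t t01; apply: F0P; rewrite /= in_itv.
Qed.

Lemma transitions_finite : exists F1 : seq G, forall s a b, a \in cs ->
  b \in cs -> QQ a s -> QQ b s ->
  (tr (UU a) a s * (tr (UU b) b s)^-1)%g \in F1.
Proof.
have [|s _|F1 F1P] := @compact_seq S G _ (fun F1 s => forall a, a \in cs ->
    forall b, b \in cs -> QQ a s -> QQ b s ->
    (tr (UU a) a s * (tr (UU b) b s)^-1)%g \in F1) cS.
- by move=> s1 s2 t s12 s1P a acs b bcs Qa Qb; apply/s12/s1P.
- exists [seq (tr (UU a) a s * (tr (UU b) b s)^-1)%g | a <- cs, b <- cs].
  apply: near_seq => a acs; apply: near_seq => b bcs.
  have cid : continuous (fun s : S => s) by move=> ?; exact: cvg_id.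
  have [Us|nQ] := @QQ_near _ _ a s cid; last by apply: filterS nQ.
  have [Vs|nQ] := @QQ_near _ _ b s cid; last by apply: filterS nQ.
  apply: filterS (tr_near homLS lnS (nUU a) (nUU b) Us Vs) => s' [Us' Vs' E] _
    _.
  rewrite -(trM homLS (nUU a) (UUa a) Us Us') -(trM homLS (nUU b) (UUa b) Vs
    Vs').
  rewrite E invgM !mulgA mulgK.
  by apply/allpairsP; exists (a, b).
by exists F1 => s a b acs bcs; apply: F1P.
Qed.

(* By [angS], the labels a and b of two consecutive members of this cover     *)
(* along an orbit determine how [ang] changes under f.                        *)
Definition coding : set (set X) := [set V | open V /\ exists a, [/\ a \in cs,
  forall x, V x -> QQ a (g x) & forall b, b \in cs -> exists c, forall x, V x ->
    QQ b (g (f x)) -> tcoef (UU a) (UU b) a b x = c]].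

Lemma open_cover_coding : open_cover coding.
Proof.
split=> [V []//|]; apply/seteqP; split=> // x _.
have [a [acs Qx]] := csP (g x).
have cgf : continuous (fun x => g (f x)) by cont.
have h1 : \forall y \near x, forall b, b \in cs -> QQ b (g (f y)) ->
    tcoef (UU a) (UU b) a b y = tcoef (UU a) (UU b) a b x.
  apply: near_seq => b bcs.
  have [Ux|nQ] := @QQ_near _ _ b x cgf; last by apply: filterS nQ.
  have := tcoef_near (nUU a) (nUU b) (UUa a) (UUa b) (QU Qx) Ux.
  by apply: filterS => y ->.
have h2 : \forall y \near x, QQ a (g y) by apply: cg; exact: open_nbhs_nbhs.
have [V [[oV Vx] VP]] : exists V : set X, open_nbhs x V /\ V `<=` [set y | QQ
  a (g y) /\
    forall b, b \in cs -> QQ b (g (f y)) ->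
    tcoef (UU a) (UU b) a b y = tcoef (UU a) (UU b) a b x].
  have : nbhs x [set y | QQ a (g y) /\ forall b, b \in cs -> QQ b (g (f y)) ->
    tcoef (UU a) (UU b) a b y = tcoef (UU a) (UU b) a b x] by apply: filterI.
  by rewrite nbhsE => -[V oV VP]; exists V.
exists V => //; split=> //; exists a; split=> // [y /VP[]//|b bcs].
by exists (tcoef (UU a) (UU b) a b x) => y /VP[_]; apply.
Qed.

Lemma angS p a b t : continuous p -> ang (f \o p) b t =
  ((psi (p 0%R))^-1 * phi (ang p a t) * tcoef (UU a) (UU b) a b (p t))%g.
Proof.
move=> cp; have csub := @subpath_continuous R X p 0 t cp.
have := phiL csub; rewrite subpath0 subpath1 => E.
rewrite /ang -[Lam (subpath (f \o p) 0 t)]/(Lam (f \o subpath p 0 t)).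
have -> : Lam (f \o subpath p 0 t) =
    ((psi (p 0%R))^-1 * (phi (Lam (subpath p 0 t)) * psi (p t)))%g.
  by rewrite E mulKg.
rewrite /tcoef -!mulgA; congr (_ * _)%g.
rewrite [RHS]mulgA -gmulfM -mulgA /th mulVg mulg1.
by rewrite mulgA.
Qed.

Variable len : G -> nat.
Hypothesis lenM : forall u v, (len (u * v)%g <= len u + len v)%N.
Hypothesis lenV : forall u, len (u^-1)%g = len u.
Hypothesis len1 : len 1%g = 0%N.

Lemma iter_continuous n : continuous (iter n f).
Proof.
elim: n => [x|n IHn]; first exact: cvg_id.
by rewrite (_ : iter n.+1 f = fun x => f (iter n f x))//; cont.
Qed.

Variable M : nat.
Hypothesis M0 : (0 < M)%N.
Hypothesis MP : forall s a b, a \in cs -> b \in cs -> QQ a s -> QQ b s ->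
  (len (tr (UU a) a s * (tr (UU b) b s)^-1)%g <= M)%N.

Lemma th_transition x a b : a \in cs -> b \in cs -> QQ a (g x) -> QQ b (g x) ->
  (len (th a x * (th b x)^-1)%g <= M)%N.
Proof.
move=> acs bcs Qa Qb; rewrite /th /theta invgM !mulgA mulgK.
exact: MP.
Qed.

Lemma mulg_insert (u v w : G) : (u * w = u * v * (v^-1 * w))%g.
Proof. by rewrite mulgA mulgK. Qed.

(** The final translate takes few values, as it is a function of the visited member of the join and
    of the initial translate in [F0]; it jumps by at most [M], so [jumps_le_card] bounds its total
    displacement. *)
Lemma len_iter_path p (F0 : seq G) n N : continuous p ->
  (forall t, 0 <= t <= 1 ->
    forall a, a \in cs -> QQ a (g (p t)) -> ang p a t \in F0) ->
  covers_by (iterated_join f coding n.+1) N ->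
  exists a b, [/\ a \in cs, b \in cs, QQ a (g (iter n f (p 0))),
    QQ b (g (iter n f (p 1))) &
    (len (th a (iter n f (p 0%R)) * Lam (iter n f \o p) *
      (th b (iter n f (p 1%R)))^-1)%g <= M * (N * (size F0).+1))%N].
Proof.
move=> cp F0P [W [WA Wcov]].
have /choice[aV aVP] (V : set X) : exists a, coding V -> [/\ a \in cs,
  forall x, V x -> QQ a (g x) & forall b, b \in cs -> exists c, forall x, V x ->
    QQ b (g (f x)) -> tcoef (UU a) (UU b) a b x = c].
  have [[_ [a aP]]|nV] := pselect (coding V); first by exists a.
  by have [a _] := csP (g (p 0)); exists a.
have /choice[U UP] i : exists U : nat -> set X,
    (forall l, (l < n.+1)%N -> coding (U l)) /\
    (forall x, W i x -> forall l, (l < n.+1)%N -> U l (iter l f x)).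
  have [U UA UW] := WA i; exists U; split=> // x; rewrite -UW => Ux l ln.
  exact: Ux.
pose ai i l := aV (U i l).
have aics i l : (l < n.+1)%N -> ai i l \in cs.
  by move=> ln; have [/(_ l ln)/aVP[]] := UP i.
have aiQ i l x : (l < n.+1)%N -> W i x -> QQ (ai i l) (g (iter l f x)).
  move=> ln Wx; have [/(_ l ln)/aVP[_ h _] UW] := UP i.
  by apply: h; apply: UW.
have cfp l : continuous (iter l f \o p).
  by have ? := @iter_continuous l; rewrite /comp; cont.
have determined i t t' : W i (p t) -> W i (p t') ->
    ang p (ai i 0) t = ang p (ai i 0) t' ->
    forall l, (l < n.+1)%N ->
    ang (iter l f \o p) (ai i l) t = ang (iter l f \o p) (ai i l) t'.
  move=> Wt Wt' E0; elim=> [//|l IHl] ln.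
  have {}IHl := IHl (ltnW ln).
  have fE : iter l.+1 f \o p = f \o (iter l f \o p) by [].
  rewrite fE !(@angS (iter l f \o p) (ai i l))// IHl; congr (_ * _)%g.
  have [Uc UW] := UP i.
  have [_ _ /(_ _ (aics i _ ln))[c cE]] := aVP _ (Uc l (ltnW ln)).
  rewrite !cE//=.
  - by apply: (UW _ Wt' l (ltnW ln)).
  - exact: (aiQ i l.+1 _ ln Wt').
  - by apply: (UW _ Wt l (ltnW ln)).
  - exact: (aiQ i l.+1 _ ln Wt).
(* The choice of a member need not be continuous in t; only the jumps of [eta] matter. *)
have /choice[I IP] (t : R) := Wcov (p (clamp t)).
pose q := iter n f \o p.
pose eta t := ang q (ai (I t) n) (clamp t).
pose d v := len ((eta 0)^-1 * v)%g.
pose key t := (I t, inord (index (ang p (ai (I t) 0) (clamp t)) F0) : 'I_(size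
  F0).+1).
have ang0F t : ang p (ai (I t) 0) (clamp t) \in F0.
  apply: F0P; [exact: clamp_itv|exact: aics|].
  exact: (aiQ (I t) 0%N _ isT (IP t)).
have cq : continuous q by exact: cfp.
have key_eta t t' : key t = key t' -> eta t = eta t'.
  move=> [It /(congr1 val)]; rewrite /= !inordK ?ltnS ?index_size// => Ei.
  rewrite /eta -It; apply: determined => //; first by rewrite It; exact: IP.
  by have := nth_index 1%g (ang0F t'); rewrite -Ei (nth_index 1%g (ang0F t))
    -It.
have jump t : \forall t' \near t,
    (d (eta t') <= d (eta t) + M)%N /\ (d (eta t) <= d (eta t') + M)%N.
  set a := ai (I t) n.
  have acs : a \in cs by exact: aics.
  have Qa : QQ a (g (q (clamp t))) by exact: (aiQ (I t) n _ (ltnSn n) (IP t)).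
  have cgq : continuous (fun t => g (q t)) by cont.
  have h1 : \forall s \near clamp t, QQ a (g (q s)).
    by apply: cgq; exact: open_nbhs_nbhs.
  have h2 := ang_near cq (QU Qa).
  have h3 : \forall s \near clamp t, QQ a (g (q s)) /\ ang q a s = ang q a
    (clamp t).
    by apply: filterS2 h1 h2 => s Qs [_].
  have {h1 h2}h3 : \forall t' \near t, QQ a (g (q (clamp t'))) /\
      ang q a (clamp t') = ang q a (clamp t) := clamp_continuous h3.
  (* With the label [a] kept, the translate is constant near t; only the change of label to [b]
     contributes, at most [M]. *)
  apply: filterS h3 => t' [Qt' angE].
  set b := ai (I t') n.
  have bcs : b \in cs by exact: aics.
  have Qb : QQ b (g (q (clamp t'))) by exact: (aiQ (I t') n _ (ltnSn n) (IP
    t')).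
  have E : ((eta t)^-1 * eta t')%g =
      (th a (q (clamp t')) * (th b (q (clamp t')))^-1)%g.
    by rewrite /eta -/a -/b -angE /ang invgM invgK mulgA mulgVK.
  have eM : (len ((eta t)^-1 * eta t')%g <= M)%N by rewrite E th_transition.
  have e1 := mulg_insert (eta 0%R)^-1%g (eta t) (eta t').
  have e2 := mulg_insert (eta 0%R)^-1%g (eta t') (eta t).
  rewrite /d; split; first by rewrite e1 (leq_trans (lenM _ _))// leq_add2l.
  rewrite e2 (leq_trans (lenM _ _))// leq_add2l.
  by rewrite -[X in (_ * X)%g]invgK -invgM lenV.
have d0 : d (eta 0) = 0%N by rewrite /d mulVg.
have := jumps_le_card M0 d0 key_eta jump; rewrite card_prod !card_ord.
have c0 : clamp 0 = 0 :> R by rewrite clamp_id ?lexx ?ler01.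
have c1 : clamp 1 = 1 :> R by rewrite clamp_id ?lexx ?ler01.
have -> : d (eta 1) = len (th (ai (I 0%R) n) (q 0%R) * Lam q *
    (th (ai (I 1%R) n) (q 1%R))^-1)%g.
  rewrite /d /eta c0 c1 /ang (Lam_subpath_id homL) mul1g invgK subpath01.
  by rewrite mulgA.
move=> le_d; exists (ai (I 0) n), (ai (I 1) n); split=> //.
- exact: aics.
- exact: aics.
- by have := aiQ (I 0) n _ (ltnSn n) (IP 0); rewrite c0.
- by have := aiQ (I 1) n _ (ltnSn n) (IP 1); rewrite c1.
Qed.

(** [beta] fixes one label at each point, so that estimates for consecutive paths can be chained.
    Changing the two end labels costs at most [2 M], hence [(size F0).+3]. *)
Lemma len_beta : exists beta : X -> G, forall p : R -> X, continuous p ->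
  exists C, forall n N, covers_by (iterated_join f coding n.+1) N ->
  (len (beta (iter n f (p 0%R)) * Lam (iter n f \o p) *
    (beta (iter n f (p 1%R)))^-1)%g <= C * N)%N.
Proof.
have /choice[bx bxP] x : exists a, a \in cs /\ QQ a (g x) by exact: csP.
exists (fun x => th (bx x) x) => p cp.
have [F0 F0P] := ang_finite cp.
exists (M * (size F0).+3)%N => n N covN.
have N0 : (0 < N)%N.
  by have [W [_ /(_ (p 0))[i _]]] := covN; exact: leq_trans (ltn_ord i).
have [a [b [acs bcs Qa Qb abM]]] := len_iter_path cp F0P covN.
set x := iter n f (p 0); set y := iter n f (p 1); set L := Lam _.
have [xcs Qx] := bxP x; have [ycs Qy] := bxP y.
have hx : (len (th (bx x) x * (th a x)^-1)%g <= M)%N by exact: th_transition.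
have hy : (len (th b y * (th (bx y) y)^-1)%g <= M)%N by exact: th_transition.
have -> : (th (bx x) x * L * (th (bx y) y)^-1)%g =
    ((th (bx x) x * (th a x)^-1) * ((th a x * L * (th b y)^-1) *
    (th b y * (th (bx y) y)^-1)))%g.
  move: (th (bx x) x) (th a x) (th b y) (th (bx y) y) => u1 u2 u3 u4.
  by rewrite !mulgA !mulgVK.
have h1 := lenM (th (bx x) x * (th a x)^-1)%g ((th a x * L * (th b y)^-1) *
    (th b y * (th (bx y) y)^-1))%g.
have h2 := lenM (th a x * L * (th b y)^-1)%g (th b y * (th (bx y) y)^-1)%g.
apply: leq_trans h1 _; apply: leq_trans (leq_add hx (leq_trans h2 (leq_add abM
  hy))) _.
have : (M <= M * N)%N by rewrite leq_pmulr.
rewrite -!mulnA; move: (size F0) => z.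
have -> : (z.+3 * N = N * z.+1 + 2 * N)%N by lia.
by rewrite mulnDr mulnCA; lia.
Qed.

(* Plays the role of psi for the n-th iterates of f and phi.                  *)
Fixpoint Psi n x : G :=
  if n is n'.+1 then (phi (Psi n' x) * psi (iter n' f x))%g else 1%g.

Let phi1 : phi 1%g = 1%g.
Proof. by apply: (mulgI (phi 1%g)); rewrite -gmulfM !mulg1. Qed.

Lemma Psi_path n p : continuous p ->
  (iter n phi (Lam p) * Psi n (p 1%R) = Psi n (p 0%R) * Lam (iter n f \o p))%g.
Proof.
move=> cp; elim: n => [|n IHn]; first by rewrite /= mulg1 mul1g.
have cnp : continuous (iter n f \o p).
  by have ? := @iter_continuous n; rewrite /comp; cont.
rewrite /= mulgA -gmulfM IHn gmulfM -mulgA.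
have -> : psi (iter n f (p 1)) = psi ((iter n f \o p) 1) by [].
by rewrite phiL// mulgA.
Qed.

Lemma Psi_shift n x : Psi n.+1 x = (iter n phi (psi x) * Psi n (f x))%g.
Proof.
elim: n => [|n IHn]; first by rewrite /= phi1 mul1g mulg1.
rewrite -[LHS]/(phi (Psi n.+1 x) * psi (iter n.+1 f x))%g IHn gmulfM -mulgA.
by rewrite iterSr.
Qed.

(** [phi^n] of the loop is the class of its n-th image conjugated by [w n], which accounts for the
    path from [x0] to its n-th iterate. Each image of [alpha] lengthens [w] by at most
    [Ca * N n.+1], whence the factor [n.+1]. *)
Lemma len_iter_loop (x0 : X) (alpha gam : R -> X) :
  continuous alpha -> alpha 0 = x0 -> alpha 1 = f x0 -> psi x0 = Lam alpha ->
  continuous gam -> gam 0 = x0 -> gam 1 = x0 ->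
  exists C, forall N : nat -> nat, {homo N : n n' / (n <= n')%N} ->
  (forall n, covers_by (iterated_join f coding n) (N n)) ->
  forall n, (len (iter n phi (Lam gam)) <= C * n.+1 * N n.+1)%N.
Proof.
move=> ca a0 a1 psiE cgam g0 g1.
have [beta betaP] := len_beta.
have [Ca CaP] := betaP _ ca; have [Cg CgP] := betaP _ cgam.
exists (2 * len (beta x0) + 2 * Ca + Cg)%N => N Nmono Ncov n.
have N0 l : (0 < N l)%N.
  by have [W [_ /(_ x0)[i _]]] := Ncov l; exact: leq_trans (ltn_ord i).
pose w l := (Psi l x0 * (beta (iter l f x0))^-1)%g.
have wS l : w l.+1 = (w l * (beta (iter l f x0) * Lam (iter l f \o alpha) *
    (beta (iter l f (f x0)))^-1))%g.
  have := Psi_path l ca; rewrite a0 a1 => E.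
  rewrite /w Psi_shift psiE E -iterSr !mulgA; congr (_ * _)%g.
  by rewrite mulgVK.
have wlen_ l : (l <= n)%N -> (len (w l) <= len (beta x0) + l * (Ca * N n.+1))%N.
  elim: l => [_|l IHl ln]; first by rewrite /w mul1g lenV addn0.
  have := CaP l (N l.+1) (Ncov _); rewrite a0 a1 wS; set t := (_ * _)%g => ht.
  have {}ht : (len t <= Ca * N n.+1)%N.
    by apply: leq_trans ht _; rewrite leq_mul2l Nmono ?orbT// ltnW.
  apply: leq_trans (lenM _ _) _.
  by have := IHl (ltnW ln); rewrite mulSn; lia.
have -> : iter n phi (Lam gam) = (w n * (beta (iter n f x0) *
    Lam (iter n f \o gam) * (beta (iter n f x0))^-1) * (w n)^-1)%g.
  have := Psi_path n cgam; rewrite g0 g1 => E.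
  apply: (mulIg (Psi n x0)); rewrite E /w invgM invgK.
  move: (beta _) (Psi n x0) (Lam _) => u v t.
  by rewrite !mulgA !mulgVK.
have h1 := wlen_ n (leqnn n).
have h2 := CgP n _ (Ncov n.+1); rewrite g0 g1 in h2.
have h3 : (len (w n * (beta (iter n f x0) * Lam (iter n f \o gam) *
    (beta (iter n f x0))^-1) * (w n)^-1)%g <= len (w n) + Cg * N n.+1 + len (w
      n))%N.
  rewrite (leq_trans (lenM _ _))// lenV leq_add2r (leq_trans (lenM _ _))//.
  by rewrite leq_add2l.
apply: leq_trans h3 _; move: h1 (N0 n.+1); move: (len (w n)) (len (beta x0))
  (N n.+1).
move=> a b c; nia.
Qed.

End word_growth.

(** * Lower bound and conclusion *)

Lemma pi1_entropy0 (R : realType) (phi : endo 0) : pi1_entropy R phi = -oo%E.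
Proof.
(* An empty maximum is 0, and 0 to a nonzero power is 0; at index 0 the exponent vanishes. *)
apply/cvg_lim => //; apply: cvg_near_cst; exists 1%N => // n n1.
rewrite big_ord0 powR0; first by rewrite le0_lneNy.
by rewrite invr_neq0// pnatr_eq0 -lt0n.
Qed.

Section endomorphism_with_remnant.
Context {m l : nat} (phi : endo m).
Hypotheses (m0 : (0 < m)%N) (l0 : (0 < l)%N) (phiS : S_ l phi).

Definition max_wlen n : nat := (\max_(i < m) wlen (iter n phi (gen i)))%N.

Lemma max_wlen_ge n : ((l * m) ^ n <= max_wlen n)%N.
Proof.
apply: leq_trans (leq_bigmax (Ordinal m0)).
elim: n => [|n IHn]; first by rewrite expn0.
by rewrite expnS (leq_trans _ (wlen_remnant _ phiS))// leq_mul2l IHn orbT.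
Qed.

Lemma max_wlen_gt0 n : (0 < max_wlen n)%N.
Proof. by rewrite (leq_trans _ (max_wlen_ge n))// expn_gt0 muln_gt0 l0 m0. Qed.

Lemma max_wlenD n k : (max_wlen (n + k) <= max_wlen n * max_wlen k)%N.
Proof. by apply/bigmax_leqP => i _; apply: wlen_iter_submul. Qed.

Lemma pi1_entropy_ge (R : realType) :
  (lne (((l * m)%N)%:R%:E : \bar R) <= pi1_entropy R phi)%E.
Proof.
have lm0 : (0 < l * m)%N by rewrite muln_gt0 l0.
rewrite (pi1_entropyE max_wlen_gt0 max_wlenD) lne_EFin ?ltr0n// lee_fin.
apply: limr_ge; first exact: ln_submultiplicative max_wlen_gt0 max_wlenD.
near=> n; have n0 : 0 < n%:R :> R by rewrite ltr0n; near: n; exists 1%N.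
rewrite ler_pdivlMr// mulr_natr -lnXn ?ltr0n// ler_ln ?posrE ?exprn_gt0
  ?ltr0n//.
  by rewrite -natrX ler_nat max_wlen_ge.
exact: max_wlen_gt0.
Unshelve. all: by end_near. Qed.

End endomorphism_with_remnant.

Theorem theorem13 (R : realType) (X : topologicalType)
    (hX : has_bounded_surface_type R X)
    (m : nat) (x0 : X) (cls : (R -> X) -> free_group m) (hG : is_pi1 x0 cls)
    (l : nat) (hl : (0 < l)%N)
    (f : X -> X) (hf : continuous f)
    (alpha : R -> X) (f_sharp : endo m)
    (hf_sharp : is_induced x0 cls f alpha f_sharp)
    (hS : S_ l f_sharp) :
  (pi1_entropy R f_sharp <= top_entropy R f)%E /\
  (lne (((l * m)%N)%:R%:E : \bar R) <= pi1_entropy R f_sharp)%E.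
Proof.
case: m => [|m] in cls hG f_sharp hf_sharp hS *.
  (* In rank 0 both the bound and the fundamental group entropy are [-oo]. *)
  by rewrite pi1_entropy0 leNye muln0 le0_lneNy.
split; last exact: pi1_entropy_ge.
have [S [surfS cS conS _ [g [k [cg ck [H [cH H01]] _]]]]] := hX.
have [hausS _ _] := surfS.
have lnS : @locally_nice R S := surface_locally_nice surfS.
pose K (z : X * R) : X := H (z.1, clamp z.2).
have cK : continuous K.
  have cc : continuous (fun z : X * R => (z.1, clamp z.2)).
    by have ? : continuous (@clamp R) := @clamp_continuous R; cont.
  apply: (within_continuous_comp cH cc) => z; split=> //=.
  by rewrite in_itv; exact: clamp_itv.
have K0 x : K (x, 0) = k (g x).
  by rewrite /K /= clamp_id ?lexx ?ler01//; have [->] := H01 x.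
have K1 x : K (x, 1) = x.
  by rewrite /K /= clamp_id ?lexx ?ler01//; have [_ ->] := H01 x.
(* Go from [x0] to [k (g x0)] along [K] reversed, then along the image of a path of S, then along
   [K] to [x]. *)
have conX x : exists p : R -> X, [/\ continuous p, p 0 = x0 & p 1 = x].
  have [p [cp p0 p1]] := locally_nice_path_connected (g x0) (g x) lnS conS.
  have cKx y : continuous (fun t => K (y, t)) by cont.
  have ckp : continuous (k \o p) by rewrite /comp; cont.
  have cI := inv_path_continuous (cKx x0).
  have I0 : inv_path (fun t => K (x0, t)) 0 = x0 by rewrite /inv_path subr0 K1.
  have I1 : inv_path (fun t => K (x0, t)) 1 = k (g x0) by rewrite /inv_path
    subrr K0.
  exists (concat (concat (inv_path (fun t => K (x0, t))) (k \o p)) (fun t => K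
    (x, t))).
  split; [|by rewrite !concat0|by rewrite concat1].
  apply: concat_continuous => //; last by rewrite concat1 /= p1 K0.
  by apply: concat_continuous; rewrite //= p0.
have [Lam [psi [beta [homL phiL surj [cb b0 b1 psi0]]]]] :=
  exists_transport conX hG hf hf_sharp.
have /choice[UQ UQP] (s : S) : exists UQ : set S * set S,
    [/\ @nice R S UQ.1, UQ.1 s, open UQ.2, UQ.2 s & closure UQ.2 `<=` UQ.1].
  have [U [nU Us _]] := lnS s setT filterT; have [oU _ _] := nU.
  have sU : nbhs s U by exact: open_nbhs_nbhs.
  have [Q Qs QU] := compact_regular hausS cS (filterT : nbhs s setT) sU.
  exists (U, interior Q); split=> //=; first exact: open_interior.
  by apply: subset_trans QU; apply: closureS; exact: interior_subset.
pose UU s := (UQ s).1; pose QQ s := (UQ s).2.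
have nUU s : @nice R S (UU s) by have [] := UQP s.
have UUs s : UU s s by have [] := UQP s.
have oQQ s : open (QQ s) by have [] := UQP s.
have clQ s : closure (QQ s) `<=` UU s by have [] := UQP s.
have [|s _|cs csP] := @compact_seq S S _ (fun cs s => exists a, a \in cs /\ QQ
  a s) cS.
- by move=> s1 s2 t s12 [a [/s12 as2 Qa]]; exists a.
- exists [:: s]; have Qs : nbhs s (QQ s).
    by apply: open_nbhs_nbhs; split=> //; have [] := UQP s.
  by apply: filterS Qs => t Qt; exists s; rewrite mem_head.
have {}csP s : exists a, a \in cs /\ QQ a s by exact: csP.
have [F1 F1P] := transitions_finite ck homL lnS cs nUU UUs clQ cS.
(* The successor makes the jump bound positive. *)
pose M := (\max_(u <- F1) wlen u).+1.
have MP s a b : a \in cs -> b \in cs -> QQ a s -> QQ b s ->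
    (wlen (tr (LamS k Lam) (UU a) a s * (tr (LamS k Lam) (UU b) b s)^-1)%g <=
      M)%N.
  move=> acs bcs Qa Qb; apply: leqW.
  exact: (leq_bigmax_seq (F := @wlen m.+1) _ (F1P _ _ _ acs bcs Qa Qb)).
pose A := coding g k K Lam f f_sharp psi UU QQ cs.
have oA : open_cover A by exact: (open_cover_coding cg ck cK K0 K1 homL hf lnS
  phiL).
apply: (le_trans (y := cover_entropy R f A)); last first.
  by apply: ereal_sup_ubound; exists A.
have [E|[N [-> N0 Ncov Nmin Nsub]]] := @cover_entropyP R X f A x0.
  by rewrite E leey.
have Nmono : {homo N : n n' / (n <= n')%N}.
  by move=> n n' nn'; apply: Nmin; apply: covers_by_join_le (Ncov n').
rewrite (pi1_entropyE (max_wlen_gt0 (ltn0Sn m) hl hS) (max_wlenD f_sharp))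
  ?lee_fin//.
have /choice[C CP] (i : 'I_m.+1) : exists C, forall n,
    (wlen (iter n f_sharp (gen i)) <= C * n.+1 * N n.+1)%N.
  have [p [cp p0 p1 <-]] := surj (gen i).
  have [C CP] := len_iter_loop cg ck cK K0 K1 homL hf phiL nUU UUs oQQ clQ
    csP wlenM wlenV (erefl : wlen (1%g : free_group m.+1) = 0%N) (ltn0Sn _) MP
      cb b0 b1 psi0 cp p0 p1.
  by exists C; apply: CP.
apply: (growth_rate_le (C := (\max_i C i)%N)) => //.
- exact: (max_wlen_gt0 (ltn0Sn m) hl hS).
- exact: max_wlenD.
move=> n; apply/bigmax_leqP => i _; apply: leq_trans (CP i n) _.
by rewrite !leq_mul2r (leq_bigmax i) !orbT.
Qed.
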